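(* There exists an absolute constant $C>0$ such that for every integer $n \ge 4$, \[ \overline{\operatorname{cr}}(K_n) \le \frac{9363184}{24609375}\binom{n}{4} + C n^3 . \] In particular $\overline{\operatorname{cr}}(K_n) \le 0.380473\binom{n}{4} + O(n^3)$.
   Context: A set of points in the plane is in general position if no three of its points are collinear. For a finite set $S$ of points in general position in the plane, $\overline{\operatorname{cr}}(S)$ denotes the number of pairs of edges that cross (at a point interior to both segments) in the rectilinear drawing of the complete graph on vertex set $S$, i.e. the drawing in which every pair of points of $S$ is joined by the straight line segment between them. The rectilinear crossing number $\overline{\operatorname{cr}}(K_n)$ is the minimum of $\overline{\operatorname{cr}}(S)$ over all sets $S$ of $n$ points in general position in the plane. *)

(* Defs.v *)
From Stdlib Require Import Reals List Arith.
Import ListNotations.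
Open Scope R_scope.

Definition point : Type := (R * R)%type.

Definition collinear (a b c : point) : Prop :=
  exists (al be ga : R), (al <> 0 \/ be <> 0) /\
    al * fst a + be * snd a = ga /\
    al * fst b + be * snd b = ga /\
    al * fst c + be * snd c = ga.

Definition general_position (P : nat -> point) (n : nat) : Prop :=
  (forall i j, (i < n)%nat -> (j < n)%nat -> i <> j -> P i <> P j) /\
  (forall i j k, (i < n)%nat -> (j < n)%nat -> (k < n)%nat ->
     i <> j -> j <> k -> i <> k -> ~ collinear (P i) (P j) (P k)).

Definition segments_cross (a b c d : point) : Prop :=
  exists s t : R, 0 < s < 1 /\ 0 < t < 1 /\
    fst a + s * (fst b - fst a) = fst c + t * (fst d - fst c) /\
    snd a + s * (snd b - snd a) = snd c + t * (snd d - snd c).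

(* (i,j,k,l) encodes the unordered pair of distinct edges {P i P j}, {P k P l}
   of the complete graph on P 0..P (n-1), with i<j, k<l, (i,j) <lex (k,l). *)
Definition edge_pair (n : nat) (q : nat * nat * nat * nat) : Prop :=
  let '(i, j, k, l) := q in
  (i < j)%nat /\ (j < n)%nat /\ (k < l)%nat /\ (l < n)%nat /\
  ((i < k)%nat \/ (i = k /\ j < l)%nat).

Definition crossing_pair (P : nat -> point) (n : nat) (q : nat * nat * nat * nat) : Prop :=
  edge_pair n q /\
  let '(i, j, k, l) := q in segments_cross (P i) (P j) (P k) (P l).

Definition cr_bar_eq (P : nat -> point) (n m : nat) : Prop :=
  exists L : list (nat * nat * nat * nat),
    NoDup L /\ (forall q, In q L <-> crossing_pair P n q) /\ length L = m.

(* Main.v *)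
Require Import Defs.
From Stdlib Require Import Reals List Arith.
From Stdlib Require Import ZArith Lia Lra Bool FinFun.
Import ListNotations.

(* Let [P] be a set of [m = 2h + 1] points.  Replace every point of [P] by a tiny
   copy of a [k]-point set [S], flattened along a line that halves the rest of [P].
   Up to lower order terms in [k], the resulting [mk] points have
     cr(P) k^4 + m h (h - 1) k^4 / 2 + m (m - 1) k^4 / 8 + m h k^4 / 6 + m cr(S)
   crossings: the summands count the quadruples with 4 points in different clusters,
   with 2 + 1 + 1, 2 + 2, 3 + 1 and 4 points in the same cluster.  Choosing [S]
   recursively gives cr(K_n) <= q binomial(n, 4) + O(n^3) with
     q = (24 cr(P) + 3 m^3 - 7 m^2 + 4 m) / (m^4 - m),
   and q < 9363184 / 24609375 holds for the explicit [P] below, which has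
   [m = 93] and cr(P) = 1087847.  The number cr(P) is computed from the numbers of
   points on the two sides of the lines through two points of [P]. *)

Open Scope Z_scope.

(** * Finite sums *)

(** Halving serves twice. Crossings of type 2 + 1 + 1 come from pairs of clusters on the same side
    of the line, and balance makes these fewest. In type 3 + 1 the orientation of the triple decides
    which side produces the crossing; with [h] clusters on both sides this choice no longer matters,
    so [S] enters only through its own crossings and the recursion closes. The ratio q is the fixed
    point of that recursion. The bounds on the summands hold for every k without an error term. The
    cubic term therefore comes only from rounding n up to a multiple of m and from the small cases.
    All geometry is done with integer coordinates: infinitely close copies become polynomials in a
    large integer [L], and only leading coefficients matter. Crossings are sums over ordered
    quadruples, so that symmetry arguments become exchanges of summation variables. The margin is
    narrow: with m = 93, a base with 1087848 crossings would still suffice, one with 1087849 would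
    not. *)

Fixpoint sum1 (n : nat) (f : nat -> Z) : Z :=
  match n with O => 0 | S n => sum1 n f + f n end.

Lemma sum_le n f g :
  (forall i, (i < n)%nat -> f i <= g i) -> sum1 n f <= sum1 n g.
Proof.
  induction n as [|n IH]; simpl; intros H; [lia|].
  pose proof (H n ltac:(lia)). assert (sum1 n f <= sum1 n g) by (apply IH; intros; apply H; lia). lia.
Qed.

Lemma sum_ext n f g :
  (forall i, (i < n)%nat -> f i = g i) -> sum1 n f = sum1 n g.
Proof.
  intros H. apply Z.le_antisymm; apply sum_le; intros i Hi; rewrite (H i Hi); lia.
Qed.

Lemma sum_add n f g : sum1 n (fun i => f i + g i) = sum1 n f + sum1 n g.
Proof. induction n; simpl; lia. Qed.

Lemma sum_scal n z f : sum1 n (fun i => z * f i) = z * sum1 n f.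
Proof. induction n; simpl; lia. Qed.

Lemma sum_const n z : sum1 n (fun _ => z) = Z.of_nat n * z.
Proof. induction n; simpl sum1; lia. Qed.

Lemma sum_swap n m f :
  sum1 n (fun i => sum1 m (fun j => f i j)) = sum1 m (fun j => sum1 n (fun i => f i j)).
Proof.
  induction n as [|n IH]; simpl.
  - symmetry. rewrite (sum_const m 0). lia.
  - rewrite sum_add, IH. reflexivity.
Qed.

Lemma sum_append n m f : sum1 (n + m) f = sum1 n f + sum1 m (fun i => f (n + i)%nat).
Proof.
  induction m as [|m IH].
  - rewrite Nat.add_0_r. simpl. lia.
  - rewrite Nat.add_succ_r. simpl. lia.
Qed.

Lemma sum_nonneg n f : (forall i, (i < n)%nat -> 0 <= f i) -> 0 <= sum1 n f.
Proof. intros H. transitivity (sum1 n (fun _ => 0)); [rewrite sum_const; lia | now apply sum_le]. Qed.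

Lemma sum_monotone n m f :
  (n <= m)%nat -> (forall i, (i < m)%nat -> 0 <= f i) -> sum1 n f <= sum1 m f.
Proof.
  intros H Hf. replace m with (n + (m - n))%nat by lia. rewrite sum_append.
  assert (0 <= sum1 (m - n) (fun i => f (n + i)%nat)) by (apply sum_nonneg; intros; apply Hf; lia).
  lia.
Qed.

(** Turns one numerical total into pointwise information. The general position of the base and the
    absence of further points on its halving lines are read off from totals in this way. *)
Lemma sum_le_eq n f g :
  (forall i, (i < n)%nat -> f i <= g i) -> sum1 n g <= sum1 n f ->
  forall i, (i < n)%nat -> f i = g i.
Proof.
  induction n as [|n IH]; simpl; intros H Hs i Hi; [lia|].
  assert (sum1 n f <= sum1 n g) by (apply sum_le; intros; apply H; lia).
  pose proof (H n ltac:(lia)).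
  destruct (Nat.eq_dec i n) as [->|]; [lia|].
  apply IH; [intros; apply H; lia | lia | lia].
Qed.

Lemma sum_divmod m k g :
  sum1 (m * k) (fun i => g (i / k)%nat (i mod k)%nat) = sum1 m (fun p => sum1 k (fun i => g p i)).
Proof.
  induction m as [|m IH]; [reflexivity|].
  replace (S m * k)%nat with (m * k + k)%nat by lia.
  rewrite sum_append, IH. simpl. f_equal. apply sum_ext. intros i Hi. f_equal.
  - rewrite Nat.div_add_l, Nat.div_small by lia. lia.
  - rewrite Nat.add_comm, Nat.Div0.mod_add. now apply Nat.mod_small.
Qed.

Definition indic (b : bool) : Z := if b then 1 else 0.

Lemma indic_bounds b : 0 <= indic b <= 1.
Proof. destruct b; simpl; lia. Qed.

Lemma sum_indic_eq n p : (p < n)%nat -> sum1 n (fun i => indic (p =? i)%nat) = 1.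
Proof.
  induction n as [|n IH]; intros H; [lia|]. simpl.
  destruct (Nat.eqb_spec p n) as [->|]; [|rewrite IH by lia; reflexivity].
  rewrite (sum_ext n _ (fun _ => 0)); [rewrite sum_const, Z.mul_0_r; reflexivity|].
  intros i Hi. destruct (Nat.eqb_spec n i); [lia|reflexivity].
Qed.

Lemma sum_delta n p f : (p < n)%nat -> sum1 n (fun i => indic (p =? i)%nat * f i) = f p.
Proof.
  intros H. rewrite (sum_ext n _ (fun i => f p * indic (p =? i)%nat)).
  - rewrite sum_scal, sum_indic_eq by assumption. lia.
  - intros i Hi. destruct (Nat.eqb_spec p i); subst; unfold indic; lia.
Qed.

Definition sum2 n (f : nat -> nat -> Z) := sum1 n (fun a => sum1 n (f a)).
Definition sum3 n (f : nat -> nat -> nat -> Z) := sum1 n (fun a => sum2 n (f a)).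
Definition sum4 n (f : nat -> nat -> nat -> nat -> Z) := sum1 n (fun a => sum3 n (f a)).

Lemma sum2_le n f g :
  (forall a b, (a < n)%nat -> (b < n)%nat -> f a b <= g a b) -> sum2 n f <= sum2 n g.
Proof. intros H. apply sum_le; intros; apply sum_le; auto. Qed.

Lemma sum3_le n f g :
  (forall a b c, (a < n)%nat -> (b < n)%nat -> (c < n)%nat -> f a b c <= g a b c) ->
  sum3 n f <= sum3 n g.
Proof. intros H. apply sum_le; intros; apply sum2_le; auto. Qed.

Lemma sum4_le n f g :
  (forall a b c d, (a < n)%nat -> (b < n)%nat -> (c < n)%nat -> (d < n)%nat ->
     f a b c d <= g a b c d) -> sum4 n f <= sum4 n g.
Proof. intros H. apply sum_le; intros; apply sum3_le; auto. Qed.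

Lemma sum2_ext n f g :
  (forall a b, (a < n)%nat -> (b < n)%nat -> f a b = g a b) -> sum2 n f = sum2 n g.
Proof. intros H. apply sum_ext; intros; apply sum_ext; auto. Qed.

Lemma sum3_ext n f g :
  (forall a b c, (a < n)%nat -> (b < n)%nat -> (c < n)%nat -> f a b c = g a b c) ->
  sum3 n f = sum3 n g.
Proof. intros H. apply sum_ext; intros; apply sum2_ext; auto. Qed.

Lemma sum4_ext n f g :
  (forall a b c d, (a < n)%nat -> (b < n)%nat -> (c < n)%nat -> (d < n)%nat ->
     f a b c d = g a b c d) -> sum4 n f = sum4 n g.
Proof. intros H. apply sum_ext; intros; apply sum3_ext; auto. Qed.

Lemma sum2_add n f g : sum2 n (fun a b => f a b + g a b) = sum2 n f + sum2 n g.
Proof. unfold sum2. rewrite <- sum_add. apply sum_ext; intros. apply sum_add. Qed.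

Lemma sum3_add n f g : sum3 n (fun a b c => f a b c + g a b c) = sum3 n f + sum3 n g.
Proof. unfold sum3. rewrite <- sum_add. apply sum_ext; intros. apply sum2_add. Qed.

Lemma sum4_add n f g :
  sum4 n (fun a b c d => f a b c d + g a b c d) = sum4 n f + sum4 n g.
Proof. unfold sum4. rewrite <- sum_add. apply sum_ext; intros. apply sum3_add. Qed.

Lemma sum2_scal n z f : sum2 n (fun a b => z * f a b) = z * sum2 n f.
Proof. unfold sum2. rewrite <- sum_scal. apply sum_ext; intros. apply sum_scal. Qed.

Lemma sum3_scal n z f : sum3 n (fun a b c => z * f a b c) = z * sum3 n f.
Proof. unfold sum3. rewrite <- sum_scal. apply sum_ext; intros. apply sum2_scal. Qed.

Lemma sum4_scal n z f : sum4 n (fun a b c d => z * f a b c d) = z * sum4 n f.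
Proof. unfold sum4. rewrite <- sum_scal. apply sum_ext; intros. apply sum3_scal. Qed.

Lemma sum2_swap n f : sum2 n (fun a b => f b a) = sum2 n f.
Proof. apply sum_swap. Qed.

Lemma sum3_swap12 n f : sum3 n (fun a b c => f b a c) = sum3 n f.
Proof. apply (sum2_swap n (fun a b => sum1 n (f a b))). Qed.

Lemma sum3_swap23 n f : sum3 n (fun a b c => f a c b) = sum3 n f.
Proof. apply sum_ext; intros a _. apply (sum2_swap n (f a)). Qed.

Lemma sum4_swap12 n f : sum4 n (fun a b c d => f b a c d) = sum4 n f.
Proof. apply (sum2_swap n (fun a b => sum2 n (f a b))). Qed.

Lemma sum4_swap23 n f : sum4 n (fun a b c d => f a c b d) = sum4 n f.
Proof. apply sum_ext; intros a _. apply (sum3_swap12 n (f a)). Qed.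

Lemma sum4_swap34 n f : sum4 n (fun a b c d => f a b d c) = sum4 n f.
Proof. apply sum_ext; intros a _. apply (sum3_swap23 n (f a)). Qed.

Lemma sum4_swap13 n f : sum4 n (fun a b c d => f c b a d) = sum4 n f.
Proof.
  rewrite <- (sum4_swap12 n f), <- (sum4_swap23 n (fun a b c d => f b a c d)).
  rewrite <- (sum4_swap12 n (fun a b c d => f c a b d)). reflexivity.
Qed.

Lemma sum4_swap_pairs n f : sum4 n (fun a b c d => f c d a b) = sum4 n f.
Proof.
  rewrite <- (sum4_swap23 n f), <- (sum4_swap12 n (fun a b c d => f a c b d)).
  rewrite <- (sum4_swap34 n (fun a b c d => f b c a d)).
  rewrite <- (sum4_swap23 n (fun a b c d => f b d a c)). reflexivity.
Qed.

(** * Crossings of a blown-up configuration *)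

Definition crossb (chi : nat -> nat -> nat -> Z) (a b c d : nat) : bool :=
  (chi a b c * chi a b d <? 0) && (chi c d a * chi c d b <? 0).

(* For the chirotope of a point set, every pair of crossing edges is counted
   8 times: order of the edges, orientation of each edge. *)
Definition crossings (chi : nat -> nat -> nat -> Z) (n : nat) : Z :=
  sum4 n (fun a b c d => indic (crossb chi a b c d)).

(** Weaker than the usual notion: sign values and alternation, without the exchange axioms of
    oriented matroids. *)
Definition chirotope (chi : nat -> nat -> nat -> Z) : Prop :=
  forall a b c, -1 <= chi a b c <= 1 /\ chi b c a = chi a b c /\ chi b a c = - chi a b c.

Lemma crossb_swap_l chi a b c d : chirotope chi -> crossb chi b a c d = crossb chi a b c d.
Proof.
  intros H. unfold crossb. f_equal.
  - destruct (H a b c) as (_ & _ & ->), (H a b d) as (_ & _ & ->). f_equal. ring.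
  - f_equal. ring.
Qed.

Lemma crossb_swap_pairs chi a b c d : crossb chi c d a b = crossb chi a b c d.
Proof. apply andb_comm. Qed.

Lemma crossb_swap_r chi a b c d : chirotope chi -> crossb chi a b d c = crossb chi a b c d.
Proof.
  intros H. rewrite crossb_swap_pairs, crossb_swap_l by assumption. apply crossb_swap_pairs.
Qed.

Lemma sum_div m k g : sum1 (m * k) (fun i => g (i / k)%nat) = Z.of_nat k * sum1 m g.
Proof.
  rewrite (sum_divmod m k (fun p _ => g p)), <- sum_scal.
  apply sum_ext; intros. apply sum_const.
Qed.

Lemma sum2_div m k g :
  sum2 (m * k) (fun a b => g (a / k)%nat (b / k)%nat) = Z.of_nat k ^ 2 * sum2 m g.
Proof.
  unfold sum2. rewrite (sum_ext _ _ (fun a => Z.of_nat k * sum1 m (g (a / k)%nat))).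
  - rewrite sum_scal, (sum_div m k (fun p => sum1 m (g p))). ring.
  - intros. apply sum_div.
Qed.

Lemma sum3_div m k g :
  sum3 (m * k) (fun a b c => g (a / k)%nat (b / k)%nat (c / k)%nat) = Z.of_nat k ^ 3 * sum3 m g.
Proof.
  unfold sum3. rewrite (sum_ext _ _ (fun a => Z.of_nat k ^ 2 * sum2 m (g (a / k)%nat))).
  - rewrite sum_scal, (sum_div m k (fun p => sum2 m (g p))). ring.
  - intros. apply sum2_div.
Qed.

Lemma sum4_div m k g :
  sum4 (m * k) (fun a b c d => g (a / k)%nat (b / k)%nat (c / k)%nat (d / k)%nat) =
  Z.of_nat k ^ 4 * sum4 m g.
Proof.
  unfold sum4. rewrite (sum_ext _ _ (fun a => Z.of_nat k ^ 3 * sum3 m (g (a / k)%nat))).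
  - rewrite sum_scal, (sum_div m k (fun p => sum3 m (g p))). ring.
  - intros. apply sum3_div.
Qed.

Lemma sum_div_eq m k p g : (p < m)%nat ->
  sum1 (m * k) (fun i => indic (p =? i / k)%nat * g (i mod k)%nat) = sum1 k g.
Proof.
  intros Hp. rewrite (sum_divmod m k (fun q i => indic (p =? q)%nat * g i)).
  rewrite (sum_ext m _ (fun q => indic (p =? q)%nat * sum1 k g)).
  - now apply sum_delta.
  - intros. apply sum_scal.
Qed.

Lemma sgn_cases z : Z.sgn z = 1 \/ Z.sgn z = 0 \/ Z.sgn z = -1.
Proof. pose proof (Z.sgn_spec z). lia. Qed.

Definition between (x y z : Z) : bool := ((x <? z) && (z <? y)) || ((y <? z) && (z <? x)).

Lemma cross_between xa xb xc o s :
  -1 <= o <= 1 -> s = 1 \/ s = -1 ->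
  indic ((o * (Z.sgn (xb - xa) * s) <? 0) &&
         (Z.sgn (xc - xa) * s * (Z.sgn (xc - xb) * s) <? 0)) <=
  indic (between xa xb xc) * indic (0 <? s * (- o * Z.sgn (xb - xa))).
Proof.
  intros Ho Hs. assert (o = 1 \/ o = 0 \/ o = -1) as Ho' by lia. clear Ho. unfold between.
  destruct (Z.sgn_spec (xb - xa)) as [[? ->]|[[? ->]|[? ->]]];
  destruct (Z.sgn_spec (xc - xa)) as [[? ->]|[[? ->]|[? ->]]];
  destruct (Z.sgn_spec (xc - xb)) as [[? ->]|[[? ->]|[? ->]]]; try lia;
  destruct (Z.ltb_spec xa xc), (Z.ltb_spec xc xb), (Z.ltb_spec xb xc), (Z.ltb_spec xc xa);
  try lia;
  destruct Hs as [-> | ->]; destruct Ho' as [-> | [-> | ->]]; cbn; lia.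
Qed.

(* The index [i < m * k] stands for the point with number [i mod k] in the
   cluster [i / k].  [chi_pair] says that the cluster of [p] is spread along a
   line, in the order of the coordinate [x], and that [side p q] tells on which
   side of this line the cluster of [q] lies. *)
Section Blowup.

Variables (m k h : nat) (chiP chiS chi : nat -> nat -> nat -> Z).
Variables (side : nat -> nat -> Z) (x : nat -> Z).
Let cl i := (i / k)%nat.
Let ix i := (i mod k)%nat.

Hypothesis chiP_chirotope : chirotope chiP.
Hypothesis chi_chirotope : chirotope chi.
Hypothesis side_diag : forall p, side p p = 0.
Hypothesis side_sign : forall p q, (p < m)%nat -> (q < m)%nat -> p <> q ->
  side p q = 1 \/ side p q = -1.
Hypothesis side_half : forall p, (p < m)%nat ->
  sum1 m (fun q => indic (side p q =? 1)) = Z.of_nat h /\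
  sum1 m (fun q => indic (side p q =? -1)) = Z.of_nat h.
Hypothesis chi_distinct : forall i j l,
  (i < m * k)%nat -> (j < m * k)%nat -> (l < m * k)%nat ->
  cl i <> cl j -> cl j <> cl l -> cl i <> cl l -> chi i j l = chiP (cl i) (cl j) (cl l).
Hypothesis chi_pair : forall i j l,
  (i < m * k)%nat -> (j < m * k)%nat -> (l < m * k)%nat ->
  cl i = cl j -> cl i <> cl l -> chi i j l = Z.sgn (x (ix j) - x (ix i)) * side (cl i) (cl l).
Hypothesis chi_same : forall i j l,
  (i < m * k)%nat -> (j < m * k)%nat -> (l < m * k)%nat ->
  cl i = cl j -> cl i = cl l -> chi i j l = chiS (ix i) (ix j) (ix l).

Let X a b c d := indic (crossb chi a b c d).
Let same a b : Z := indic (cl a =? cl b)%nat.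
Let diff a b : Z := 1 - same a b.

Lemma cl_lt i : (i < m * k)%nat -> (cl i < m)%nat.
Proof. intros H. apply Nat.Div0.div_lt_upper_bound. lia. Qed.

(* The crossings of [ab] with [cd] such that exactly [a] and [c] share a
   cluster, such that [a], [c] and [b], [d] do, and such that [a], [b], [c] do. *)
Let S13 a b c d := same a c * diff a b * diff a d * diff b d * X a b c d.
Let S1324 a b c d := same a c * same b d * diff a b * X a b c d.
Let S123 a b c d := same a b * same a c * diff a d * X a b c d.

(** Points of one cluster lie on the same side of any line through two points of other clusters:
    [chi c d a] and [chi c d b] agree, so their product is a square. *)
Lemma cross_pair_separated a b c d :
  (a < m * k)%nat -> (b < m * k)%nat -> (c < m * k)%nat -> (d < m * k)%nat ->
  cl a = cl b -> cl a <> cl c -> cl a <> cl d -> X a b c d = 0.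
Proof.
  intros Ha Hb Hc Hd E N1 N2. unfold X, crossb.
  assert (chi c d a * chi c d b >= 0) as Hs.
  { destruct (Nat.eq_dec (cl c) (cl d)) as [E'|N3].
    - rewrite !chi_pair by congruence. rewrite E. nia.
    - rewrite !chi_distinct by congruence. rewrite E. nia. }
  destruct (Z.ltb_spec (chi c d a * chi c d b) 0); [lia|]. now rewrite andb_false_r.
Qed.

Lemma chi_pair23 i j l :
  (i < m * k)%nat -> (j < m * k)%nat -> (l < m * k)%nat ->
  cl j = cl l -> cl i <> cl j -> chi i j l = Z.sgn (x (ix l) - x (ix j)) * side (cl j) (cl i).
Proof.
  intros. rewrite <- chi_pair by congruence. symmetry. apply chi_chirotope.
Qed.

Lemma chi_pair13 i j l :
  (i < m * k)%nat -> (j < m * k)%nat -> (l < m * k)%nat ->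
  cl i = cl l -> cl i <> cl j -> chi i j l = Z.sgn (x (ix i) - x (ix l)) * side (cl i) (cl j).
Proof.
  intros Hi Hj Hl E N. rewrite E, <- chi_pair by congruence. apply chi_chirotope.
Qed.

(* Swapping the two points that share a cluster reverses one sign in the crossing
   condition, so at most one of the two crossings occurs. *)
Lemma cross_S13 a b c d :
  (a < m * k)%nat -> (b < m * k)%nat -> (c < m * k)%nat -> (d < m * k)%nat ->
  S13 a b c d + S13 c b a d <=
  same a c * (diff b d * indic (0 <? side (cl a) (cl b) * side (cl a) (cl d))).
Proof.
  intros Ha Hb Hc Hd. unfold S13, diff, same.
  rewrite (Nat.eqb_sym (cl c) (cl a)).
  destruct (Nat.eqb_spec (cl a) (cl c)) as [E|]; [rewrite <- E|cbn [indic]; lia].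
  pose proof (indic_bounds (cl b =? cl d)%nat).
  pose proof (indic_bounds (0 <? side (cl a) (cl b) * side (cl a) (cl d))).
  destruct (Nat.eqb_spec (cl a) (cl b)) as [|N1]; [cbn [indic]; nia|].
  destruct (Nat.eqb_spec (cl a) (cl d)) as [|N2]; [cbn [indic]; nia|].
  destruct (Nat.eqb_spec (cl b) (cl d)) as [|N3]; [cbn [indic]; nia|].
  unfold X, crossb.
  rewrite (chi_pair13 a b c), (chi_pair13 c b a), (chi_pair13 c d a), (chi_pair13 a d c),
    !chi_distinct by congruence.
  rewrite <- E.
  destruct (chiP_chirotope (cl a) (cl b) (cl d)) as (Ho & _ & _).
  destruct (chiP_chirotope (cl d) (cl a) (cl b)) as (_ & E1 & E2). rewrite E2, <- E1.
  set (o := chiP (cl a) (cl b) (cl d)) in *.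
  assert (o = 1 \/ o = 0 \/ o = -1) as Ho' by lia. clearbody o. clear Ho E1 E2.
  replace (x (ix a) - x (ix c)) with (- (x (ix c) - x (ix a))) by ring.
  rewrite Z.sgn_opp. pose proof (sgn_cases (x (ix c) - x (ix a))) as Hs.
  destruct (side_sign (cl a) (cl b)) as [-> | ->];
    [auto using cl_lt | auto using cl_lt | assumption | |];
  (destruct (side_sign (cl a) (cl d)) as [-> | ->];
    [auto using cl_lt | auto using cl_lt | assumption | |]);
  destruct Hs as [-> | [-> | ->]]; destruct Ho' as [-> | [-> | ->]]; cbn; lia.
Qed.

(** Exchanging [a] and [c] reverses [chi a b c], but [chi a b d] depends on [a] only through its
    cluster. The product of the two changes sign, so at most one of the two crossings occurs. *)
Lemma cross_S1324 a b c d :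
  (a < m * k)%nat -> (b < m * k)%nat -> (c < m * k)%nat -> (d < m * k)%nat ->
  S1324 a b c d + S1324 c b a d <= same a c * (same b d * diff a b).
Proof.
  intros Ha Hb Hc Hd. unfold S1324, diff, same.
  rewrite (Nat.eqb_sym (cl c) (cl a)).
  destruct (Nat.eqb_spec (cl a) (cl c)) as [E|]; [rewrite <- E|cbn [indic]; lia].
  destruct (Nat.eqb_spec (cl b) (cl d)) as [E'|]; [|cbn [indic]; lia].
  destruct (Nat.eqb_spec (cl a) (cl b)) as [|N1]; [cbn [indic]; lia|].
  unfold X, crossb.
  rewrite (chi_pair13 a b c), (chi_pair13 c b a), (chi_pair13 c d a), (chi_pair13 a d c),
   (chi_pair23 a b d), (chi_pair23 c b d), (chi_pair23 c d b), (chi_pair23 a d b)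
    by congruence.
  rewrite <- E, <- E'.
  replace (x (ix a) - x (ix c)) with (- (x (ix c) - x (ix a))) by ring.
  replace (x (ix b) - x (ix d)) with (- (x (ix d) - x (ix b))) by ring.
  rewrite !Z.sgn_opp. pose proof (sgn_cases (x (ix c) - x (ix a))) as Hs.
  pose proof (sgn_cases (x (ix d) - x (ix b))) as Hs'.
  destruct (side_sign (cl a) (cl b)) as [-> | ->];
    [auto using cl_lt | auto using cl_lt | assumption | |];
  (destruct (side_sign (cl b) (cl a)) as [-> | ->];
    [auto using cl_lt | auto using cl_lt | congruence | |]);
  destruct Hs as [-> | [-> | ->]]; destruct Hs' as [-> | [-> | ->]]; cbn; lia.
Qed.

Let btw a b c : Z := indic (between (x (ix a)) (x (ix b)) (x (ix c))).

Lemma btw_cycle a b c : btw a b c + btw b c a + btw c a b <= 1.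
Proof.
  unfold btw, between.
  repeat match goal with |- context [?u <? ?v] => destruct (Z.ltb_spec u v) end; cbn; lia.
Qed.

(** In a flattened cluster, [cd] can meet [ab] only if [c] lies between [a] and [b] along the line
    and [d] lies on the side of the line away from [c]. The last indicator expresses the latter
    through the orientation of the triple. *)
Lemma cross_S123 a b c d :
  (a < m * k)%nat -> (b < m * k)%nat -> (c < m * k)%nat -> (d < m * k)%nat ->
  S123 a b c d <= same a b * same a c * btw a b c *
    indic (0 <? side (cl a) (cl d) * (- chi a b c * Z.sgn (x (ix b) - x (ix a)))).
Proof.
  intros Ha Hb Hc Hd. unfold S123, diff, same, btw.
  pose proof (indic_bounds (between (x (ix a)) (x (ix b)) (x (ix c)))).
  set (t := - chi a b c * _).
  pose proof (indic_bounds (0 <? side (cl a) (cl d) * t)).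
  destruct (Nat.eqb_spec (cl a) (cl b)) as [E|]; [|cbn [indic]; lia].
  destruct (Nat.eqb_spec (cl a) (cl c)) as [E'|]; [|cbn [indic]; lia].
  destruct (Nat.eqb_spec (cl a) (cl d)) as [|N]; [cbn [indic]; nia|].
  unfold X, crossb, t.
  rewrite (chi_pair a b d), (chi_pair13 c d a), (chi_pair13 c d b) by congruence.
  rewrite <- E'. cbn [indic].
  rewrite <- (Z.mul_1_l (indic _)), !Z.mul_1_l. apply cross_between.
  - apply chi_chirotope.
  - apply side_sign; auto using cl_lt.
Qed.

Lemma cross_S12 a b c d :
  (a < m * k)%nat -> (b < m * k)%nat -> (c < m * k)%nat -> (d < m * k)%nat ->
  cl a = cl b -> cl a <> cl c -> cl a <> cl d -> X a b c d = 0 /\ X c d a b = 0.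
Proof.
  intros. split; [now apply cross_pair_separated|].
  unfold X. rewrite crossb_swap_pairs. now apply cross_pair_separated.
Qed.

Let XP a b c d := indic (crossb chiP a b c d).
Let XS a b c d := indic (crossb chiS a b c d).
Let S1234 a b c d := same a b * same a c * same a d * XS (ix a) (ix b) (ix c) (ix d).

(** One group of terms for each way of distributing the four points over clusters that allows a
    crossing; the variants inside a group say which endpoints coincide. When the endpoints of an
    edge share a cluster that the other edge avoids, there is no crossing by [cross_S12]. *)
Lemma cross_decompose a b c d :
  (a < m * k)%nat -> (b < m * k)%nat -> (c < m * k)%nat -> (d < m * k)%nat ->
  X a b c d <= XP (cl a) (cl b) (cl c) (cl d) +
    (S13 a b c d + S13 b a c d + S13 a b d c + S13 b a d c) +
    (S1324 a b c d + S1324 a b d c) +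
    (S123 a b c d + S123 a b d c + S123 c d a b + S123 c d b a) + S1234 a b c d.
Proof.
  intros Ha Hb Hc Hd. unfold S13, S1324, S123, S1234, X, diff.
  rewrite !(crossb_swap_l chi a b), (crossb_swap_r chi a b c d), (crossb_swap_r chi c d a b),
    (crossb_swap_pairs chi a b c d) by assumption.
  pose proof (cross_S12 a b c d Ha Hb Hc Hd) as H12.
  pose proof (cross_S12 c d a b Hc Hd Ha Hb) as H34.
  assert (cl a = cl b -> cl a = cl c -> cl a = cl d ->
    crossb chi a b c d = crossb chiS (ix a) (ix b) (ix c) (ix d)) as Hall.
  { intros. unfold crossb. now rewrite !chi_same by congruence. }
  assert (cl a <> cl b -> cl a <> cl c -> cl a <> cl d -> cl b <> cl c -> cl b <> cl d ->
    cl c <> cl d -> crossb chi a b c d = crossb chiP (cl a) (cl b) (cl c) (cl d)) as Hnone.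
  { intros. unfold crossb. now rewrite !chi_distinct by congruence. }
  unfold X in H12, H34. unfold XP, XS.
  pose proof (indic_bounds (crossb chi a b c d)) as B0.
  pose proof (indic_bounds (crossb chiP (cl a) (cl b) (cl c) (cl d))) as B1.
  pose proof (indic_bounds (crossb chiS (ix a) (ix b) (ix c) (ix d))) as B2.
  unfold same.
  rewrite ?(Nat.eqb_sym (cl c) (cl a)), ?(Nat.eqb_sym (cl b) (cl a)), ?(Nat.eqb_sym (cl d) (cl a)),
    ?(Nat.eqb_sym (cl c) (cl b)), ?(Nat.eqb_sym (cl d) (cl b)), ?(Nat.eqb_sym (cl d) (cl c)).
  destruct (Nat.eqb_spec (cl a) (cl b)), (Nat.eqb_spec (cl a) (cl c)), (Nat.eqb_spec (cl a) (cl d)),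
    (Nat.eqb_spec (cl b) (cl c)), (Nat.eqb_spec (cl b) (cl d)), (Nat.eqb_spec (cl c) (cl d));
    try congruence; cbn [indic];
    first [ lia
          | rewrite Hall by assumption; lia
          | rewrite Hnone by assumption; lia
          | destruct H12 as [-> _]; [congruence..|]; lia
          | destruct H34 as [_ ->]; [congruence..|]; lia ].
Qed.

(** At most one of three points is the middle one, so the three cyclic shifts of the summand add up
    to at most 1 on each triple of a cluster. *)
Lemma same_sum3 :
  3 * sum3 (m * k) (fun a b c => same a b * same a c * btw a b c) <= Z.of_nat k ^ 3 * Z.of_nat m.
Proof.
  set (f a b c := same a b * same a c * btw a b c).
  assert (sum3 (m * k) (fun a b c => f b c a) = sum3 (m * k) f) as E1.
  { rewrite <- (sum3_swap23 _ f). rewrite <- (sum3_swap12 _ (fun a b c => f a c b)). reflexivity. }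
  assert (sum3 (m * k) (fun a b c => f c a b) = sum3 (m * k) f) as E2.
  { rewrite <- (sum3_swap12 _ f). rewrite <- (sum3_swap23 _ (fun a b c => f b a c)). reflexivity. }
  transitivity (sum3 (m * k) (fun a b c => f a b c + (f b c a + f c a b))).
  { rewrite !sum3_add, E1, E2. lia. }
  transitivity (sum3 (m * k) (fun a b c => same a b * same a c)).
  - apply sum3_le. intros a b c _ _ _. unfold f, same. pose proof (btw_cycle a b c).
    assert (0 <= btw a b c) by apply indic_bounds.
    assert (0 <= btw b c a) by apply indic_bounds.
    assert (0 <= btw c a b) by apply indic_bounds.
    destruct (Nat.eqb_spec (cl a) (cl b)), (Nat.eqb_spec (cl a) (cl c)),
      (Nat.eqb_spec (cl b) (cl c)), (Nat.eqb_spec (cl b) (cl a)), (Nat.eqb_spec (cl c) (cl a)),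
      (Nat.eqb_spec (cl c) (cl b)); try congruence; cbn [indic]; lia.
  - unfold same, cl.
    rewrite (sum3_div m k (fun p q r => indic (p =? q)%nat * indic (p =? r)%nat)).
    apply Z.eq_le_incl. f_equal. unfold sum3, sum2.
    rewrite (sum_ext m _ (fun _ => 1)); [rewrite sum_const; lia|].
    intros p Hp. rewrite (sum_ext m _ (fun q => indic (p =? q)%nat)); [now apply sum_indic_eq|].
    intros q _. rewrite sum_scal, sum_indic_eq by assumption. lia.
Qed.

(** The bound does not depend on the sign of [t], because both sides hold [h] clusters; this removes
    the orientations inside [S] from the 3 + 1 count. *)
Lemma side_count p t :
  (p < m)%nat -> sum1 m (fun q => indic (0 <? side p q * t)) <= Z.of_nat h.
Proof.
  intros Hp. destruct (side_half p Hp) as [H1 H2].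
  destruct (Z.lt_trichotomy t 0) as [Ht|[->|Ht]].
  - rewrite <- H2. apply sum_le. intros q Hq. destruct (Nat.eq_dec p q) as [<-|N].
    + rewrite side_diag. cbn. lia.
    + destruct (side_sign p q Hp Hq N) as [-> | ->]; destruct (Z.ltb_spec 0 (1 * t));
      destruct (Z.ltb_spec 0 (-1 * t)); cbn; lia.
  - rewrite (sum_ext m _ (fun _ => 0)); [rewrite sum_const; lia|].
    intros. now rewrite Z.mul_0_r.
  - rewrite <- H1. apply sum_le. intros q Hq. destruct (Nat.eq_dec p q) as [<-|N].
    + rewrite side_diag. cbn. lia.
    + destruct (side_sign p q Hp Hq N) as [-> | ->]; destruct (Z.ltb_spec 0 (1 * t));
      destruct (Z.ltb_spec 0 (-1 * t)); cbn; lia.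
Qed.

Lemma sum_S123 : 3 * sum4 (m * k) S123 <= Z.of_nat k ^ 4 * (Z.of_nat m * Z.of_nat h).
Proof.
  assert (sum4 (m * k) S123 <= Z.of_nat k * Z.of_nat h *
            sum3 (m * k) (fun a b c => same a b * same a c * btw a b c)) as H.
  { rewrite <- sum3_scal.
    change (sum4 (m * k) S123) with (sum3 (m * k) (fun a b c => sum1 (m * k) (S123 a b c))).
    apply sum3_le. intros a b c Ha Hb Hc.
    set (t := - chi a b c * Z.sgn (x (ix b) - x (ix a))).
    transitivity (sum1 (m * k) (fun d => same a b * same a c * btw a b c *
      indic (0 <? side (cl a) (cl d) * t))).
    { apply sum_le. intros. now apply cross_S123. }
    rewrite sum_scal, (sum_div m k (fun q => indic (0 <? side (cl a) q * t)) :
      sum1 _ (fun d => indic (0 <? side (cl a) (cl d) * t)) = _).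
    pose proof (side_count (cl a) t (cl_lt a Ha)).
    assert (0 <= same a b * same a c * btw a b c)
      by (repeat apply Z.mul_nonneg_nonneg; apply indic_bounds).
    rewrite (Z.mul_comm (Z.of_nat k * Z.of_nat h)).
    apply Z.mul_le_mono_nonneg_l; [assumption|].
    apply Z.mul_le_mono_nonneg_l; [lia|assumption]. }
  pose proof (Z.mul_le_mono_nonneg_l _ _ (Z.of_nat k * Z.of_nat h) ltac:(lia) same_sum3) as H'.
  replace (Z.of_nat k ^ 4 * _) with
    (Z.of_nat k * Z.of_nat h * (Z.of_nat k ^ 3 * Z.of_nat m)) by ring.
  lia.
Qed.

Lemma sum_S13 :
  2 * sum4 (m * k) S13 <=
  Z.of_nat k ^ 4 * (Z.of_nat m * (2 * Z.of_nat h * (Z.of_nat h - 1))).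
Proof.
  transitivity (sum4 (m * k) (fun a b c d => S13 a b c d + S13 c b a d)).
  { rewrite sum4_add, (sum4_swap13 _ S13). lia. }
  set (f p q s := (1 - indic (q =? s)%nat) * indic (0 <? side p q * side p s)).
  transitivity (sum4 (m * k) (fun a b c d => indic (cl a =? cl c)%nat * f (cl a) (cl b) (cl d))).
  { apply sum4_le. intros. now apply cross_S13. }
  unfold cl. rewrite (sum4_div m k (fun p q r s => indic (p =? r)%nat * f p q s)).
  apply Z.mul_le_mono_nonneg_l; [apply Z.pow_nonneg; lia|].
  rewrite <- (sum4_swap23 m), <- (sum_const m). apply sum_le. intros p Hp.
  unfold sum3 at 1.
  rewrite (sum_ext m _ (fun r => indic (p =? r)%nat * sum2 m (f p))) by
    (intros; apply sum2_scal).
  rewrite sum_delta by assumption. destruct (side_half p Hp) as [H1 H2].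
  set (u q := indic (side p q =? 1)) in *. set (v q := indic (side p q =? -1)) in *.
  (* Two clusters are on the same side when both are counted by [u] or both by [v]; the last term
     removes the diagonal. The total is [h * h + h * h - 2 * h]. *)
  rewrite (sum2_ext m _ (fun q s => u q * u s + v q * v s +
    -1 * (indic (q =? s)%nat * (u s + v s)))).
  - rewrite !sum2_add, sum2_scal. unfold sum2.
    rewrite (sum_ext m (fun a => sum1 m (fun b => u a * u b)) (fun a => Z.of_nat h * u a)),
      (sum_ext m (fun a => sum1 m (fun b => v a * v b)) (fun a => Z.of_nat h * v a)),
      (sum_ext m (fun a => sum1 m (fun b => indic _ * _)) (fun a => u a + v a)),
      !sum_scal, sum_add, H1, H2; [lia|..].
    + intros. now rewrite sum_delta.
    + intros. rewrite sum_scal, H2. ring.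
    + intros. rewrite sum_scal, H1. ring.
  - intros q s Hq Hs. unfold f, u, v. destruct (Nat.eq_dec p q) as [<-|N1].
    + rewrite side_diag. cbn. destruct (Nat.eqb_spec p s) as [<-|]; [rewrite side_diag|]; reflexivity.
    + destruct (Nat.eq_dec p s) as [<-|N2].
      * rewrite side_diag, Z.mul_0_r. destruct (Nat.eqb_spec q p); [congruence|]. cbn. lia.
      * destruct (side_sign p q Hp Hq N1) as [E | E], (side_sign p s Hp Hs N2) as [E' | E'];
        rewrite E, E'; destruct (Nat.eqb_spec q s); try reflexivity; congruence.
Qed.

Lemma sum_S1324 :
  2 * sum4 (m * k) S1324 <= Z.of_nat k ^ 4 * (Z.of_nat m * (Z.of_nat m - 1)).
Proof.
  transitivity (sum4 (m * k) (fun a b c d => S1324 a b c d + S1324 c b a d)).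
  { rewrite sum4_add, (sum4_swap13 _ S1324). lia. }
  transitivity (sum4 (m * k) (fun a b c d => indic (cl a =? cl c)%nat *
    (indic (cl b =? cl d)%nat * (1 - indic (cl a =? cl b)%nat)))).
  { apply sum4_le. intros. now apply cross_S1324. }
  unfold cl. rewrite (sum4_div m k (fun p q r s => indic (p =? r)%nat *
    (indic (q =? s)%nat * (1 - indic (p =? q)%nat)))).
  apply Z.mul_le_mono_nonneg_l; [apply Z.pow_nonneg; lia|].
  rewrite <- (sum4_swap23 m), <- (sum_const m). apply sum_le. intros p Hp.
  unfold sum3.
  rewrite (sum_ext m _ (fun r => indic (p =? r)%nat *
    sum2 m (fun q s => indic (q =? s)%nat * (1 - indic (p =? q)%nat)))) by
    (intros; apply sum2_scal).
  rewrite sum_delta by assumption. unfold sum2.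
  rewrite (sum_ext m _ (fun q => 1 + -1 * indic (p =? q)%nat)).
  - rewrite sum_add, sum_scal, sum_const, sum_indic_eq by assumption. lia.
  - intros q Hq. rewrite sum_delta by assumption. lia.
Qed.

Lemma sum_S1234 : sum4 (m * k) S1234 = Z.of_nat m * crossings chiS k.
Proof.
  rewrite <- sum_const.
  rewrite <- (sum_ext m (fun _ => sum1 k (fun a => sum3 k (XS a)))) by reflexivity.
  rewrite <- (sum_divmod m k (fun _ a => sum3 k (XS a))).
  apply sum_ext. intros a Ha. pose proof (cl_lt a Ha) as Hp.
  unfold sum3, sum2, S1234, same, cl.
  rewrite <- (sum_div_eq m k (a / k) _ Hp). apply sum_ext. intros b _.
  rewrite <- (sum_div_eq m k (a / k) _ Hp), <- sum_scal. apply sum_ext. intros c _.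
  rewrite <- (sum_div_eq m k (a / k) _ Hp), <- !sum_scal. apply sum_ext. intros d _.
  unfold ix. ring.
Qed.

(** The multiplicities 4, 2 and 4 of [S13], [S1324] and [S123] are the numbers of variants in
    [cross_decompose], all with equal sums by relabelling. The factor 3 clears the denominator of
    the 3 + 1 count. *)
Theorem crossings_blowup :
  3 * crossings chi (m * k) <=
  Z.of_nat k ^ 4 * (3 * crossings chiP m + 12 * (Z.of_nat m * Z.of_nat h * (Z.of_nat h - 1)) +
                    3 * (Z.of_nat m * (Z.of_nat m - 1)) + 4 * (Z.of_nat m * Z.of_nat h)) +
  3 * Z.of_nat m * crossings chiS k.
Proof.
  assert (crossings chi (m * k) <= Z.of_nat k ^ 4 * crossings chiP m + 4 * sum4 (m * k) S13 +
    2 * sum4 (m * k) S1324 + 4 * sum4 (m * k) S123 + sum4 (m * k) S1234) as H.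
  { unfold crossings. rewrite <- (sum4_div m k).
    etransitivity; [apply sum4_le, cross_decompose|].
    rewrite !sum4_add, (sum4_swap12 _ S13), (sum4_swap34 _ S13), (sum4_swap34 _ S1324),
      (sum4_swap34 _ S123), (sum4_swap_pairs _ S123),
      (sum4_swap34 _ (fun a b c d => S13 b a c d)), (sum4_swap12 _ S13),
      (sum4_swap_pairs _ (fun a b c d => S123 a b d c)), (sum4_swap34 _ S123).
    unfold XP, cl. lia. }
  pose proof sum_S13. pose proof sum_S1324. pose proof sum_S123. pose proof sum_S1234. lia.
Qed.

End Blowup.

(** * Integer point sets *)

Definition det (u v : Z * Z) : Z := fst u * snd v - snd u * fst v.
Definition vec (a b : Z * Z) : Z * Z := (fst b - fst a, snd b - snd a).
Definition orient (a b c : Z * Z) : Z := det (vec a b) (vec a c).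

Definition chi (s : nat -> Z * Z) (i j k : nat) : Z := Z.sgn (orient (s i) (s j) (s k)).

Lemma chi_chirotope s : chirotope (chi s).
Proof.
  intros a b c. unfold chi. repeat split.
  - pose proof (sgn_cases (orient (s a) (s b) (s c))). lia.
  - pose proof (sgn_cases (orient (s a) (s b) (s c))). lia.
  - f_equal. unfold orient, det, vec. simpl. ring.
  - rewrite <- Z.sgn_opp. f_equal. unfold orient, det, vec. simpl. ring.
Qed.

Definition zgeneral (s : nat -> Z * Z) (n : nat) : Prop :=
  (forall i j, (i < n)%nat -> (j < n)%nat -> i <> j -> s i <> s j) /\
  (forall i j k, (i < n)%nat -> (j < n)%nat -> (k < n)%nat ->
     i <> j -> j <> k -> i <> k -> chi s i j k <> 0).

(** If two points coincided, every third index would give a vanishing orientation. The case [n = 0]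
    is there for blow-ups with empty clusters. *)
Lemma zgeneral_of_chi s n :
  (n = 0 \/ 3 <= n)%nat ->
  (forall i j k, (i < n)%nat -> (j < n)%nat -> (k < n)%nat ->
     i <> j -> j <> k -> i <> k -> chi s i j k <> 0) ->
  zgeneral s n.
Proof.
  intros Hn H. split; [|assumption]. intros i j Hi Hj N E.
  assert (exists k, (k < n)%nat /\ j <> k /\ i <> k) as (k & Hk & N1 & N2).
  { destruct (Nat.eq_dec i 0), (Nat.eq_dec j 0), (Nat.eq_dec i 1), (Nat.eq_dec j 1);
    first [exists 0%nat; lia | exists 1%nat; lia | exists 2%nat; lia]. }
  apply (H i j k); auto. unfold chi. rewrite E. unfold orient, det, vec. simpl.
  rewrite !Z.sub_diag. reflexivity.
Qed.

(** * Signs of integer polynomials at a large argument *)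

Definition eventually (P : Z -> Prop) : Prop := exists L0, forall L, L0 <= L -> P L.

Lemma eventually_impl (P R : Z -> Prop) :
  (forall L, P L -> R L) -> eventually P -> eventually R.
Proof. intros H [L0 H0]. exists L0. auto. Qed.

Lemma eventually_and P R : eventually P -> eventually R -> eventually (fun L => P L /\ R L).
Proof.
  intros [a Ha] [b Hb]. exists (Z.max a b). intros L HL. split; [apply Ha|apply Hb]; lia.
Qed.

Lemma eventually_true (P : Z -> Prop) : (forall L, P L) -> eventually P.
Proof. exists 0. auto. Qed.

Lemma eventually_forall n (P : nat -> Z -> Prop) :
  (forall i, (i < n)%nat -> eventually (P i)) ->
  eventually (fun L => forall i, (i < n)%nat -> P i L).
Proof.
  induction n as [|n IH]; intros H; [apply eventually_true; lia|].
  assert (eventually (fun L => forall i, (i < n)%nat -> P i L)) as H1 by auto.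
  apply (eventually_impl (fun L => (forall i, (i < n)%nat -> P i L) /\ P n L)).
  - intros L [HL Hn] i Hi. destruct (Nat.eq_dec i n) as [->|]; [assumption|]. apply HL. lia.
  - apply eventually_and; auto.
Qed.

Lemma sgn_horner c z L : c <> 0 -> Z.abs z < L -> Z.sgn (c * L + z) = Z.sgn c.
Proof.
  intros Hc HL. destruct (Z.lt_trichotomy c 0) as [H|[H|H]]; [|contradiction|].
  - rewrite (Z.sgn_neg c), Z.sgn_neg by nia. reflexivity.
  - rewrite (Z.sgn_pos c), Z.sgn_pos by nia. reflexivity.
Qed.

(** Induction step for polynomials in Horner form. Integrality replaces growth estimates: a nonzero
    value [f L] has absolute value at least 1, so [f L * L] dominates [z] once [L] exceeds
    [Z.abs z]. *)
Lemma eventually_sgn_horner (f : Z -> Z) c z :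
  c <> 0 -> eventually (fun L => Z.sgn (f L) = Z.sgn c) ->
  eventually (fun L => Z.sgn (f L * L + z) = Z.sgn c).
Proof.
  intros Hc [L0 H]. exists (Z.max L0 (Z.abs z + 1)). intros L HL.
  rewrite <- (H L) by lia. apply sgn_horner; [|lia].
  intros E. specialize (H L ltac:(lia)). rewrite E in H. simpl in H.
  pose proof (Z.sgn_spec c). lia.
Qed.

(* With [L] large, [lift L a u v] is an infinitely close copy of [a] displaced
   along [u], and further displaced along [v] at a smaller scale. *)
Definition lift (L : Z) (a u v : Z * Z) : Z * Z :=
  (L * L * fst a + L * fst u + fst v, L * L * snd a + L * snd u + snd v).

Lemma eventually_orient_lift a u v a' u' v' a'' u'' v'' :
  orient a a' a'' <> 0 ->
  eventually (fun L => Z.sgn (orient (lift L a u v) (lift L a' u' v') (lift L a'' u'' v'')) =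
                       Z.sgn (orient a a' a'')).
Proof.
  intros Ho. set (o := orient a a' a'') in *.
  set (b := vec a a'). set (w := vec u u'). set (y := vec v v').
  set (c := vec a a''). set (x := vec u u''). set (z := vec v v'').
  apply (eventually_impl (fun L =>
    Z.sgn ((((o * L + (det b x + det w c)) * L + (det b z + det w x + det y c)) * L +
      (det w z + det y x)) * L + det y z) = Z.sgn o)).
  - intros L <-. f_equal. unfold o, orient, b, w, y, c, x, z, det, vec, lift. cbn [fst snd]. ring.
  - repeat apply eventually_sgn_horner; try assumption. apply eventually_true. reflexivity.
Qed.

(** With a common centre [a] the terms of degree 4 cancel. The leading coefficient is the side of
    [a''] relative to the line through [a] with the direction in which the two copies differ. *)
Lemma eventually_orient_lift_pair a u v u' v' a'' u'' v'' :
  det (vec u u') (vec a a'') <> 0 ->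
  eventually (fun L => Z.sgn (orient (lift L a u v) (lift L a u' v') (lift L a'' u'' v'')) =
                       Z.sgn (det (vec u u') (vec a a''))).
Proof.
  intros Ho. set (w := vec u u') in *. set (c := vec a a'') in *.
  set (y := vec v v'). set (x := vec u u''). set (z := vec v v'').
  apply (eventually_impl (fun L =>
    Z.sgn ((((det w c) * L + (det w x + det y c)) * L +
      (det w z + det y x)) * L + det y z) = Z.sgn (det w c))).
  - intros L <-. f_equal. unfold orient, w, y, c, x, z, det, vec, lift. cbn [fst snd]. ring.
  - repeat apply eventually_sgn_horner; try assumption. apply eventually_true. reflexivity.
Qed.

Lemma orient_shear T a b c :
  orient (fst a * T + snd a, snd a) (fst b * T + snd b, snd b) (fst c * T + snd c, snd c) =
  T * orient a b c.
Proof. unfold orient, det, vec. simpl. ring. Qed.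

(** A shear with a large factor [T], followed by no change of sign since [orient] is multiplied by
    [T > 0]. Distinct first coordinates are needed because they order a cluster along its halving
    line. *)
Lemma exists_distinct_fst s n : zgeneral s n ->
  exists s', (forall i j, (i < n)%nat -> (j < n)%nat -> i <> j -> fst (s' i) <> fst (s' j)) /\
    forall i j k, chi s' i j k = chi s i j k.
Proof.
  intros [Hd _].
  assert (eventually (fun T => forall i, (i < n)%nat -> forall j, (j < n)%nat -> i <> j ->
    fst (s i) * T + snd (s i) <> fst (s j) * T + snd (s j))) as [T0 HT].
  { apply eventually_forall. intros i Hi. apply eventually_forall. intros j Hj.
    exists (Z.abs (snd (s j) - snd (s i)) + 1). intros T HT N E.
    pose proof (Hd i j Hi Hj N) as Hij.
    destruct (Z.eq_dec (fst (s i)) (fst (s j))) as [E1|N1].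
    - apply Hij. rewrite (surjective_pairing (s i)), (surjective_pairing (s j)).
      f_equal; nia.
    - nia. }
  exists (fun i => (fst (s i) * Z.max T0 1 + snd (s i), snd (s i))). split.
  - intros i j Hi Hj N. apply HT; auto; lia.
  - intros i j k. unfold chi. rewrite orient_shear, Z.sgn_mul, (Z.sgn_pos (Z.max T0 1)) by lia. lia.
Qed.

Lemma crossings_ext f g n : (forall i j k, f i j k = g i j k) -> crossings f n = crossings g n.
Proof.
  intros H. apply sum4_ext. intros. unfold crossb. now rewrite !H.
Qed.

(** * Realising the blow-up by integer points *)

Section Construction.

Variables (m k h : nat) (p d s : nat -> Z * Z).
Hypothesis Hm : (3 <= m)%nat.
Hypothesis p_general : zgeneral p m.
Hypothesis s_general : zgeneral s k.
Let side a b := Z.sgn (det (d a) (vec (p a) (p b))).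
Hypothesis side_nonzero : forall a b, (a < m)%nat -> (b < m)%nat -> a <> b -> side a b <> 0.
Hypothesis side_half : forall a, (a < m)%nat ->
  sum1 m (fun b => indic (side a b =? 1)) = Z.of_nat h /\
  sum1 m (fun b => indic (side a b =? -1)) = Z.of_nat h.

Lemma exists_blowup :
  exists s', zgeneral s' (m * k) /\
  3 * crossings (chi s') (m * k) <=
  Z.of_nat k ^ 4 * (3 * crossings (chi p) m + 12 * (Z.of_nat m * Z.of_nat h * (Z.of_nat h - 1)) +
                    3 * (Z.of_nat m * (Z.of_nat m - 1)) + 4 * (Z.of_nat m * Z.of_nat h)) +
  3 * Z.of_nat m * crossings (chi s) k.
Proof.
  destruct (exists_distinct_fst s k s_general) as (t & t_fst & t_chi).
  rewrite <- (crossings_ext _ _ k t_chi).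
  set (cl i := (i / k)%nat). set (ix i := (i mod k)%nat).
  (* The first coordinate of [t] is laid along [d], the second along [d] turned by a quarter turn
     and one scale lower. Within a cluster this multiplies orientations by [L] times the squared
     length of [d], which is positive. *)
  set (q L i := lift L (p (cl i)) (fst (t (ix i)) * fst (d (cl i)), fst (t (ix i)) * snd (d (cl i)))
    (- snd (t (ix i)) * snd (d (cl i)), snd (t (ix i)) * fst (d (cl i)))).
  assert (forall i, (i < m * k)%nat -> (cl i < m)%nat) as Hcl.
  { intros i Hi. apply Nat.Div0.div_lt_upper_bound. lia. }
  assert (forall i, (i < m * k)%nat -> (ix i < k)%nat) as Hix.
  { intros i Hi. apply Nat.mod_upper_bound. lia. }
  assert (eventually (fun L => forall i, (i < m * k)%nat -> forall j, (j < m * k)%nat ->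
    forall l, (l < m * k)%nat ->
    (cl i <> cl j -> cl j <> cl l -> cl i <> cl l ->
       chi (q L) i j l = chi p (cl i) (cl j) (cl l)) /\
    (cl i = cl j -> cl i <> cl l ->
       chi (q L) i j l = Z.sgn (fst (t (ix j)) - fst (t (ix i))) * side (cl i) (cl l)))) as HL.
  { apply eventually_forall. intros i Hi. apply eventually_forall. intros j Hj.
    apply eventually_forall. intros l Hl. apply eventually_and.
    - destruct (Nat.eq_dec (cl i) (cl j)); [apply eventually_true; congruence|].
      destruct (Nat.eq_dec (cl j) (cl l)); [apply eventually_true; congruence|].
      destruct (Nat.eq_dec (cl i) (cl l)); [apply eventually_true; congruence|].
      eapply eventually_impl; [|apply eventually_orient_lift].
      + intros L E _ _ _. exact E.
      + intros E. destruct p_general as [_ Hp].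
        apply (Hp (cl i) (cl j) (cl l)); auto. unfold chi. now rewrite E.
    - destruct (Nat.eq_dec (cl i) (cl j)) as [E|]; [|apply eventually_true; congruence].
      destruct (Nat.eq_dec (cl i) (cl l)) as [|N]; [apply eventually_true; congruence|].
      destruct (Nat.eq_dec (ix i) (ix j)) as [E'|N'].
      + apply eventually_true. intros L _ _. unfold chi, q. rewrite <- E, <- E', Z.sub_diag.
        unfold orient, vec, det. simpl. rewrite !Z.sub_diag. reflexivity.
      + pose proof (side_nonzero (cl i) (cl l) (Hcl i Hi) (Hcl l Hl) N) as Hs.
        pose proof (t_fst (ix j) (ix i) (Hix j Hj) (Hix i Hi) ltac:(congruence)) as Ht.
        unfold side in *. rewrite <- Z.sgn_mul.
        replace ((fst (t (ix j)) - fst (t (ix i))) * det (d (cl i)) (vec (p (cl i)) (p (cl l))))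
          with (det (vec (fst (t (ix i)) * fst (d (cl i)), fst (t (ix i)) * snd (d (cl i)))
                           (fst (t (ix j)) * fst (d (cl i)), fst (t (ix j)) * snd (d (cl i))))
                      (vec (p (cl i)) (p (cl l)))) by (unfold det, vec; simpl; ring).
        eapply eventually_impl; [|apply eventually_orient_lift_pair].
        * intros L EL _ _. unfold chi, q. rewrite <- E. exact EL.
        * intros E0. apply Hs. apply Z.sgn_null_iff.
          assert ((fst (t (ix j)) - fst (t (ix i))) *
                  det (d (cl i)) (vec (p (cl i)) (p (cl l))) = 0) as E1.
          { rewrite <- E0. unfold det, vec. simpl. ring. }
          apply Z.mul_eq_0 in E1. destruct E1; [lia|assumption]. }
  destruct HL as [L0 HL]. set (L := Z.max L0 1). specialize (HL L ltac:(lia)).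
  assert (forall i j l, (i < m * k)%nat -> (j < m * k)%nat -> (l < m * k)%nat ->
    cl i = cl j -> cl i = cl l -> chi (q L) i j l = chi t (ix i) (ix j) (ix l)) as Hsame.
  { intros i j l Hi Hj Hl E E'. unfold chi, q. rewrite <- E, <- E'.
    (* Another cluster is needed only to see that [d] is nonzero: otherwise its side would be 0. *)
    assert (exists b, (b < m)%nat /\ cl i <> b) as (b & Hb & N).
    { destruct (Nat.eq_dec (cl i) 0); [exists 1%nat | exists 0%nat]; lia. }
    pose proof (side_nonzero (cl i) b (Hcl i Hi) Hb N) as Hs.
    assert (0 < fst (d (cl i)) ^ 2 + snd (d (cl i)) ^ 2) as Hd.
    { assert (fst (d (cl i)) <> 0 \/ snd (d (cl i)) <> 0); [|nia].
      destruct (Z.eq_dec (fst (d (cl i))) 0) as [E1|]; [|now left].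
      destruct (Z.eq_dec (snd (d (cl i))) 0) as [E2|]; [|now right].
      exfalso. apply Hs. unfold side, det. rewrite E1, E2. reflexivity. }
    rewrite <- (Z.mul_1_l (Z.sgn (orient (t _) _ _))).
    rewrite <- (Z.sgn_pos (L * (fst (d (cl i)) ^ 2 + snd (d (cl i)) ^ 2)))
      by (apply Z.mul_pos_pos; [unfold L; lia|assumption]).
    rewrite <- Z.sgn_mul. f_equal. unfold orient, det, vec, lift. cbn [fst snd]. ring. }
  exists (q L). split.
  - assert (forall i j, cl i = cl j -> i <> j -> ix i <> ix j) as Hne.
    { intros i j E N E'. apply N. rewrite (Nat.div_mod_eq i k), (Nat.div_mod_eq j k).
      fold (cl i) (cl j) (ix i) (ix j). congruence. }
    assert (forall i j l, (i < m * k)%nat -> (j < m * k)%nat -> (l < m * k)%nat ->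
      i <> j -> cl i = cl j -> cl i <> cl l -> chi (q L) i j l <> 0) as Hpair.
    { intros i j l Hi Hj Hl N E N'. destruct (HL i Hi j Hj l Hl) as [_ ->]; [|assumption..].
      pose proof (t_fst (ix i) (ix j) (Hix i Hi) (Hix j Hj) (Hne i j E N)).
      pose proof (side_nonzero (cl i) (cl l) (Hcl i Hi) (Hcl l Hl) N').
      pose proof (Z.sgn_spec (fst (t (ix j)) - fst (t (ix i)))). nia. }
    apply zgeneral_of_chi; [destruct (Nat.eq_dec k 0); nia|]. intros i j l Hi Hj Hl N1 N2 N3.
    destruct (Nat.eq_dec (cl i) (cl j)) as [E1|M1]; [|
    destruct (Nat.eq_dec (cl j) (cl l)) as [E2|M2]; [|
    destruct (Nat.eq_dec (cl i) (cl l)) as [E3|M3]]].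
    + destruct (Nat.eq_dec (cl i) (cl l)) as [E3|M3]; [|now apply Hpair].
      rewrite Hsame, t_chi by assumption. apply s_general; auto; apply Hne; congruence.
    + destruct (chi_chirotope (q L) i j l) as (_ & <- & _). apply Hpair; congruence.
    + destruct (chi_chirotope (q L) l i j) as (_ & E & _). rewrite E.
      apply Hpair; congruence.
    + destruct (HL i Hi j Hj l Hl) as [-> _]; auto. apply p_general; auto.
  - apply (crossings_blowup m k h (chi p) (chi t) (chi (q L)) side (fun i => fst (t i)));
    auto using chi_chirotope.
    + intros a. unfold side, det, vec. simpl. now rewrite !Z.sub_diag, !Z.mul_0_r.
    + intros a b Ha Hb N. pose proof (side_nonzero a b Ha Hb N).
      pose proof (sgn_cases (det (d a) (vec (p a) (p b)))). unfold side in *. lia.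
    + intros. now apply HL.
    + intros. now apply HL.
Qed.

End Construction.

(** * Crossing number and separating pairs *)

Definition all_diff2 (a b : nat) : Z := 1 - indic (a =? b)%nat.
(** The second factor is an indicator only for distinct [a] and [b]; the first one kills the other
    case. Being linear in the equality indicators, it sums over [c] to [n - 2]. *)
Definition all_diff3 a b c : Z :=
  all_diff2 a b * (1 - indic (a =? c)%nat - indic (b =? c)%nat).
Definition all_diff4 a b c d : Z :=
  all_diff3 a b c * (1 - indic (a =? d)%nat - indic (b =? d)%nat - indic (c =? d)%nat).

Lemma sum2_all_diff n : sum2 n all_diff2 = Z.of_nat n * (Z.of_nat n - 1).
Proof.
  unfold sum2. rewrite <- sum_const. apply sum_ext. intros a Ha.
  unfold all_diff2. rewrite (sum_ext n _ (fun b => 1 + -1 * indic (a =? b)%nat)) by (intros; lia).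
  rewrite sum_add, sum_scal, sum_const, sum_indic_eq by assumption. lia.
Qed.

Lemma sum3_all_diff n : sum3 n all_diff3 = Z.of_nat n * (Z.of_nat n - 1) * (Z.of_nat n - 2).
Proof.
  rewrite <- sum2_all_diff, Z.mul_comm, <- sum2_scal. apply sum2_ext. intros a b Ha Hb.
  unfold all_diff3. rewrite sum_scal.
  rewrite (sum_ext n _ (fun c => (1 + -1 * indic (a =? c)%nat) + -1 * indic (b =? c)%nat))
    by (intros; lia).
  rewrite !sum_add, !sum_scal, sum_const, !sum_indic_eq by assumption. ring.
Qed.

Lemma sum4_all_diff n :
  sum4 n all_diff4 = Z.of_nat n * (Z.of_nat n - 1) * (Z.of_nat n - 2) * (Z.of_nat n - 3).
Proof.
  rewrite <- sum3_all_diff, Z.mul_comm, <- sum3_scal. apply sum3_ext. intros a b c Ha Hb Hc.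
  unfold all_diff4. rewrite sum_scal.
  rewrite (sum_ext n _ (fun d => ((1 + -1 * indic (a =? d)%nat) + -1 * indic (b =? d)%nat)
    + -1 * indic (c =? d)%nat)) by (intros; lia).
  rewrite !sum_add, !sum_scal, sum_const, !sum_indic_eq by assumption. ring.
Qed.

Lemma sum2_le_eq n f g :
  (forall a b, (a < n)%nat -> (b < n)%nat -> f a b <= g a b) -> sum2 n g <= sum2 n f ->
  forall a b, (a < n)%nat -> (b < n)%nat -> f a b = g a b.
Proof.
  intros H Hs a b Ha Hb. apply (sum_le_eq n (f a) (g a)); auto.
  apply Z.eq_le_incl. symmetry.
  apply (sum_le_eq n (fun a => sum1 n (f a)) (fun a => sum1 n (g a))); auto.
  intros. apply sum_le. auto.
Qed.

Lemma sum3_le_eq n f g :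
  (forall a b c, (a < n)%nat -> (b < n)%nat -> (c < n)%nat -> f a b c <= g a b c) ->
  sum3 n g <= sum3 n f ->
  forall a b c, (a < n)%nat -> (b < n)%nat -> (c < n)%nat -> f a b c = g a b c.
Proof.
  intros H Hs a b c Ha Hb Hc. apply (sum2_le_eq n (f a) (g a)); auto.
  apply Z.eq_le_incl. symmetry.
  apply (sum_le_eq n (fun a => sum2 n (f a)) (fun a => sum2 n (g a))); auto.
  intros. apply sum2_le. auto.
Qed.

Lemma chi_diag s a b : chi s a a b = 0 /\ chi s a b a = 0 /\ chi s b a a = 0.
Proof.
  assert (chi s a a b = 0) as H.
  { unfold chi, orient, det, vec. simpl. now rewrite !Z.sub_diag. }
  destruct (chi_chirotope s a a b) as (_ & H1 & _), (chi_chirotope s a b a) as (_ & H2 & _).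
  lia.
Qed.

(** The line through [a] and [b] separates [c] from [d]. Two edges cross exactly when each separates
    the endpoints of the other. *)
Definition sep (f : nat -> nat -> nat -> Z) a b c d : Z := indic (f a b c * f a b d <? 0).

(* Four points in convex position have one crossing and two separating pairs, four
   points in non-convex position no crossing and three separating pairs. *)
Lemma quadruple_signs s a b c d :
  chi s a b c <> 0 -> chi s a b d <> 0 -> chi s a c d <> 0 -> chi s b c d <> 0 ->
  let X a b c d := indic (crossb (chi s) a b c d) in
  let Y := sep (chi s) in
  X a b c d + X a c b d + X a d b c +
  (Y a b c d + Y c d a b + (Y a c b d + Y b d a c) + (Y a d b c + Y b c a d)) = 3.
Proof.
  intros H1 H2 H3 H4 X Y. unfold X, Y, crossb, sep.
  destruct (chi_chirotope s a b c) as (B1 & E1 & F1), (chi_chirotope s b c a) as (_ & E2 & F2),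
    (chi_chirotope s c a b) as (_ & _ & F3).
  destruct (chi_chirotope s a b d) as (B2 & E4 & F4), (chi_chirotope s b d a) as (_ & E5 & F5),
    (chi_chirotope s d a b) as (_ & _ & F6).
  destruct (chi_chirotope s a c d) as (B3 & E7 & F7), (chi_chirotope s c d a) as (_ & E8 & F8),
    (chi_chirotope s d a c) as (_ & _ & F9).
  destruct (chi_chirotope s b c d) as (B4 & E10 & F10), (chi_chirotope s c d b) as (_ & E11 & F11),
    (chi_chirotope s d b c) as (_ & _ & F12).
  rewrite ?E1, ?E2, ?E4, ?E5, ?E7, ?E8, ?E10, ?E11 in *.
  rewrite ?F1, ?F2, ?F3, ?F4, ?F5, ?F6, ?F7, ?F8, ?F9, ?F10, ?F11, ?F12.
  clear E1 E2 E4 E5 E7 E8 E10 E11 F1 F2 F3 F4 F5 F6 F7 F8 F9 F10 F11 F12.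
  (* This relation excludes the two sign patterns that four points of the plane cannot have. *)
  assert (orient (s b) (s c) (s d) - orient (s a) (s c) (s d) + orient (s a) (s b) (s d)
    - orient (s a) (s b) (s c) = 0) as Hid.
  { unfold orient, det, vec. simpl. ring. }
  unfold chi in *.
  destruct (Z.sgn_spec (orient (s a) (s b) (s c))) as [[? E1]|[[? E1]|[? E1]]];
  destruct (Z.sgn_spec (orient (s a) (s b) (s d))) as [[? E2]|[[? E2]|[? E2]]];
  destruct (Z.sgn_spec (orient (s a) (s c) (s d))) as [[? E3]|[[? E3]|[? E3]]];
  destruct (Z.sgn_spec (orient (s b) (s c) (s d))) as [[? E4]|[[? E4]|[? E4]]];
  try lia; rewrite E1, E2, E3, E4; reflexivity.
Qed.

Lemma sep_neq s a b c d : sep (chi s) a b c d <> 0 ->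
  a <> b /\ a <> c /\ a <> d /\ b <> c /\ b <> d /\ c <> d.
Proof.
  unfold sep. intros H.
  assert (forall u v, chi s u u v = 0) as E1 by apply chi_diag.
  assert (forall u v, chi s u v u = 0) as E2 by apply chi_diag.
  assert (forall u v, chi s v u u = 0) as E3 by (intros u v; apply (chi_diag s u v)).
  repeat split; intros <-; apply H; rewrite ?E1, ?E2, ?E3, ?Z.mul_0_r; try reflexivity.
  destruct (Z.ltb_spec (chi s a b c * chi s a b c) 0); [nia|reflexivity].
Qed.

Lemma all_diff4_distinct a b c d :
  a <> b -> a <> c -> a <> d -> b <> c -> b <> d -> c <> d -> all_diff4 a b c d = 1.
Proof.
  intros. unfold all_diff4, all_diff3, all_diff2.
  destruct (Nat.eqb_spec a b), (Nat.eqb_spec a c), (Nat.eqb_spec a d), (Nat.eqb_spec b c),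
    (Nat.eqb_spec b d), (Nat.eqb_spec c d); try contradiction; reflexivity.
Qed.

Lemma all_diff4_cases a b c d :
  (a <> b /\ a <> c /\ a <> d /\ b <> c /\ b <> d /\ c <> d) \/ all_diff4 a b c d = 0.
Proof.
  unfold all_diff4, all_diff3, all_diff2.
  destruct (Nat.eqb_spec a b); [right; reflexivity|].
  destruct (Nat.eqb_spec a c), (Nat.eqb_spec b c); try congruence; [right; reflexivity..|].
  destruct (Nat.eqb_spec a d), (Nat.eqb_spec b d), (Nat.eqb_spec c d); try congruence;
  try (right; reflexivity). left. auto 6.
Qed.

(** Sum [quadruple_signs] over all ordered quadruples. By relabelling, its three crossing terms have
    equal sums and so do its six separation terms; then divide by 3. Quadruples with a repetition
    contribute nothing, by [sep_neq]. *)
Lemma crossings_sep s n : zgeneral s n ->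
  crossings (chi s) n + 2 * sum4 n (sep (chi s)) =
  Z.of_nat n * (Z.of_nat n - 1) * (Z.of_nat n - 2) * (Z.of_nat n - 3).
Proof.
  intros [_ Hs]. rewrite <- sum4_all_diff.
  set (X a b c d := indic (crossb (chi s) a b c d)). set (Y := sep (chi s)).
  change (crossings (chi s) n) with (sum4 n X).
  assert (sum4 n (fun a b c d => X a b c d + X a c b d + X a d b c +
    (Y a b c d + Y c d a b + (Y a c b d + Y b d a c) + (Y a d b c + Y b c a d))) =
    sum4 n (fun a b c d => 3 * all_diff4 a b c d)) as H.
  { apply sum4_ext. intros a b c d Ha Hb Hc Hd.
    destruct (all_diff4_cases a b c d) as [(N1 & N2 & N3 & N4 & N5 & N6)|E].
    - rewrite all_diff4_distinct by assumption. apply quadruple_signs; apply Hs; auto.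
    - assert (forall u v w z, X u v w z = Y u v w z * Y w z u v) as HX.
      { intros u v w z. unfold X, Y, sep, crossb.
        destruct (chi s u v w * chi s u v z <? 0), (chi s w z u * chi s w z v <? 0); reflexivity. }
      rewrite !HX.
      assert (forall u v w z, Y u v w z = 0 \/
        u <> v /\ u <> w /\ u <> z /\ v <> w /\ v <> z /\ w <> z) as HY.
      { intros u v w z. destruct (Z.eq_dec (Y u v w z) 0); [now left|right].
        now apply (sep_neq s). }
      assert (~ (a <> b /\ a <> c /\ a <> d /\ b <> c /\ b <> d /\ c <> d)) as HN.
      { intros (? & ? & ? & ? & ? & ?). rewrite all_diff4_distinct in E; congruence. }
      destruct (HY a b c d) as [->|]; [|exfalso; apply HN; intuition congruence].
      destruct (HY c d a b) as [->|]; [|exfalso; apply HN; intuition congruence].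
      destruct (HY a c b d) as [->|]; [|exfalso; apply HN; intuition congruence].
      destruct (HY b d a c) as [->|]; [|exfalso; apply HN; intuition congruence].
      destruct (HY a d b c) as [->|]; [|exfalso; apply HN; intuition congruence].
      destruct (HY b c a d) as [->|]; [|exfalso; apply HN; intuition congruence].
      rewrite E. reflexivity. }
  rewrite sum4_scal, !sum4_add in H.
  assert (forall f, sum4 n (fun a b c d => f a d b c) = sum4 n f) as E1.
  { intros f. rewrite <- (sum4_swap23 n f). apply (sum4_swap34 n (fun a b c d => f a c b d)). }
  rewrite (sum4_swap23 n X), (E1 X), (sum4_swap_pairs n Y), (sum4_swap23 n Y), (E1 Y) in H.
  assert (sum4 n (fun a b c d => Y b d a c) = sum4 n Y) as E2.
  { rewrite <- (sum4_swap_pairs n Y). apply (sum4_swap23 n (fun a b c d => Y c d a b)). }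
  assert (sum4 n (fun a b c d => Y b c a d) = sum4 n Y) as E3.
  { rewrite <- (sum4_swap23 n Y). apply (sum4_swap12 n (fun a b c d => Y a c b d)). }
  lia.
Qed.

(** * Computing separations from a list of points *)

Definition count_pos (s : nat -> Z * Z) n (a u : Z * Z) : Z :=
  sum1 n (fun c => indic (0 <? det u (vec a (s c)))).
Definition count_neg (s : nat -> Z * Z) n (a u : Z * Z) : Z :=
  sum1 n (fun c => indic (det u (vec a (s c)) <? 0)).

(** Reduces a sum over quadruples to one over pairs, so that the crossings of the base can be
    evaluated in cubic time. *)
Lemma sum_sep s n :
  sum4 n (sep (chi s)) =
  2 * sum2 n (fun a b => count_pos s n (s a) (vec (s a) (s b)) *
                         count_neg s n (s a) (vec (s a) (s b))).
Proof.
  rewrite <- sum2_scal. apply sum2_ext. intros a b _ _.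
  unfold count_pos, count_neg.
  set (u c := indic (0 <? det (vec (s a) (s b)) (vec (s a) (s c)))).
  set (v c := indic (det (vec (s a) (s b)) (vec (s a) (s c)) <? 0)).
  rewrite (sum2_ext n _ (fun c d => u c * v d + v c * u d)).
  - rewrite sum2_add. unfold sum2.
    rewrite (sum_ext n (fun c => sum1 n (fun d => u c * v d)) (fun c => sum1 n v * u c)),
      (sum_ext n (fun c => sum1 n (fun d => v c * u d)) (fun c => sum1 n u * v c)), !sum_scal.
    + change (sum1 n (fun c => u c)) with (sum1 n u). change (sum1 n (fun c => v c)) with (sum1 n v). ring.
    + intros. rewrite sum_scal. ring.
    + intros. rewrite sum_scal. ring.
  - intros c d _ _. unfold sep, chi, u, v, orient.
    destruct (Z.sgn_spec (det (vec (s a) (s b)) (vec (s a) (s c)))) as [[? ->]|[[? ->]|[? ->]]];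
    destruct (Z.sgn_spec (det (vec (s a) (s b)) (vec (s a) (s d)))) as [[? ->]|[[? ->]|[? ->]]];
    repeat match goal with |- context [?u <? ?v] => destruct (Z.ltb_spec u v) end; cbn; lia.
Qed.

Lemma sum_first n f : sum1 (S n) f = f O + sum1 n (fun i => f (S i)).
Proof. exact (sum_append 1 n f). Qed.

Fixpoint sum_pairs {T} (f : T -> Z * Z) (l : list T) : Z * Z :=
  match l with
  | nil => (0, 0)
  | a :: l => let (x, y) := f a in let (z, w) := sum_pairs f l in (x + z, y + w)
  end.

Lemma sum_pairs_spec {T} (f : T -> Z * Z) l o :
  sum_pairs f l = (sum1 (length l) (fun i => fst (f (nth i l o))),
                   sum1 (length l) (fun i => snd (f (nth i l o)))).
Proof.
  induction l as [|a l IH]; [reflexivity|].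
  cbn [sum_pairs length]. rewrite IH, !sum_first. cbn [nth].
  destruct (f a). reflexivity.
Qed.

Definition sides (l : list (Z * Z)) (a u : Z * Z) : Z * Z :=
  let z := det u a in
  sum_pairs (fun c => match Z.compare (det u c) z with
                      | Gt => (1, 0) | Lt => (0, 1) | Eq => (0, 0) end) l.

Lemma sides_spec l o a u :
  sides l a u = (count_pos (fun i => nth i l o) (length l) a u,
                 count_neg (fun i => nth i l o) (length l) a u).
Proof.
  unfold sides. rewrite (sum_pairs_spec _ _ o). unfold count_pos, count_neg.
  f_equal; apply sum_ext; intros i _.
  - replace (det u (vec a (nth i l o))) with (det u (nth i l o) - det u a)
      by (unfold det, vec; simpl; ring).
    destruct (Z.compare_spec (det u (nth i l o)) (det u a)), (Z.ltb_spec 0 (det u (nth i l o) - det u a));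
    cbn; lia.
  - replace (det u (vec a (nth i l o))) with (det u (nth i l o) - det u a)
      by (unfold det, vec; simpl; ring).
    destruct (Z.compare_spec (det u (nth i l o)) (det u a)), (Z.ltb_spec (det u (nth i l o) - det u a) 0);
    cbn; lia.
Qed.

(* The determinants [det a c] are tabulated once, since
   [det (b - a) (c - a) = det b c - det a c - det b a]. *)
Definition separations (l : list (Z * Z)) : Z * Z :=
  let rows := map (fun a => (a, map (det a) l)) l in
  sum_pairs (fun ra => sum_pairs (fun rb =>
    let w := det (fst rb) (fst ra) in
    let (x, y) := sum_pairs (fun xy => match Z.compare (snd xy - fst xy) w with
                                       | Gt => (1, 0) | Lt => (0, 1) | Eq => (0, 0) end)
                    (combine (snd ra) (snd rb)) in
    (x * y, x + y)) rows) rows.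

Lemma sum_pairs_map {T U} (f : U -> Z * Z) (g : T -> U) l :
  sum_pairs f (map g l) = sum_pairs (fun a => f (g a)) l.
Proof. induction l as [|a l IH]; cbn; [reflexivity|now rewrite IH]. Qed.

Lemma sum_pairs_ext {T} (f g : T -> Z * Z) l :
  (forall a, f a = g a) -> sum_pairs f l = sum_pairs g l.
Proof. intros H. induction l as [|a l IH]; cbn; [reflexivity|now rewrite H, IH]. Qed.

Lemma combine_map {T U V} (f : T -> U) (g : T -> V) l :
  combine (map f l) (map g l) = map (fun a => (f a, g a)) l.
Proof. induction l as [|a l IH]; cbn; [reflexivity|now rewrite IH]. Qed.

Lemma separations_sides l :
  separations l =
  sum_pairs (fun a => sum_pairs (fun b => let (x, y) := sides l a (vec a b) in (x * y, x + y)) l) l.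
Proof.
  unfold separations. rewrite sum_pairs_map. apply sum_pairs_ext. intros a.
  rewrite sum_pairs_map. apply sum_pairs_ext. intros b. cbn [fst snd].
  rewrite combine_map, sum_pairs_map. unfold sides.
  rewrite (sum_pairs_ext _ (fun c => match det (vec a b) c ?= det (vec a b) a with
    | Gt => (1, 0) | Lt => (0, 1) | Eq => (0, 0) end)); [reflexivity|].
  intros c. cbn [fst snd].
  replace (det b c - det a c) with (det (vec a b) c) by (unfold det, vec; cbn; ring).
  replace (det b a) with (det (vec a b) a) by (unfold det, vec; cbn; ring).
  reflexivity.
Qed.

Definition halved (h : Z) (b : list ((Z * Z) * (Z * Z))) : bool :=
  let l := map fst b in
  forallb (fun au => let (x, y) := sides l (fst au) (snd au) in (x =? h) && (y =? h)) b.

(** * What the two computations on the base certify *)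

Section Checker.

Variables (b : list ((Z * Z) * (Z * Z))) (h : nat) (v : Z).
Let m := length b.
Let o : (Z * Z) * (Z * Z) := ((0, 0), (0, 0)).
Let p i := fst (nth i b o).
Let d i := snd (nth i b o).
Let side i j := Z.sgn (det (d i) (vec (p i) (p j))).
Hypothesis b_separations :
  separations (map fst b) = (v, Z.of_nat m * (Z.of_nat m - 1) * (Z.of_nat m - 2)).
Hypothesis b_halved : halved (Z.of_nat h) b = true.

Lemma nth_map_fst i : nth i (map fst b) (fst o) = p i.
Proof. apply map_nth. Qed.

Lemma sides_checked a u :
  sides (map fst b) a u = (count_pos p m a u, count_neg p m a u).
Proof.
  rewrite (sides_spec _ (fst o)), length_map. unfold count_pos, count_neg.
  f_equal; apply sum_ext; intros; now rewrite nth_map_fst.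
Qed.

Lemma separations_checked :
  v = sum2 m (fun i j => count_pos p m (p i) (vec (p i) (p j)) *
                         count_neg p m (p i) (vec (p i) (p j))) /\
  sum2 m (fun i j => count_pos p m (p i) (vec (p i) (p j)) +
                     count_neg p m (p i) (vec (p i) (p j))) =
  Z.of_nat m * (Z.of_nat m - 1) * (Z.of_nat m - 2).
Proof.
  rewrite separations_sides, (sum_pairs_spec _ _ (fst o)) in b_separations.
  rewrite length_map in b_separations. injection b_separations as <- <-.
  split; [|symmetry]; apply sum_ext; intros i _; rewrite (sum_pairs_spec _ _ (fst o)), length_map;
  cbn [fst snd]; apply sum_ext; intros j _; rewrite sides_checked, !nth_map_fst; reflexivity.
Qed.

(** The second total of [separations] counts ordered triples with nonzero orientation. It equals the
    number of triples of distinct indices, so no such triple can be collinear. *)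
Lemma base_general : (3 <= m)%nat -> zgeneral p m.
Proof.
  intros Hm.
  destruct separations_checked as [_ H].
  apply zgeneral_of_chi; [lia|]. intros i j l Hi Hj Hl N1 N2 N3.
  assert (indic (0 <? det (vec (p i) (p j)) (vec (p i) (p l))) +
    indic (det (vec (p i) (p j)) (vec (p i) (p l)) <? 0) = all_diff3 i j l) as E.
  { apply (sum3_le_eq m (fun i j l => indic (0 <? det (vec (p i) (p j)) (vec (p i) (p l))) +
      indic (det (vec (p i) (p j)) (vec (p i) (p l)) <? 0))); try assumption.
    - clear. intros i j l _ _ _. unfold all_diff3, all_diff2.
      set (z := det _ _).
      assert (indic (0 <? z) + indic (z <? 0) <= 1) as B.
      { destruct (Z.ltb_spec 0 z), (Z.ltb_spec z 0); cbn; lia. }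
      assert (i = j \/ i = l \/ j = l -> z = 0) as Hz.
      { intros E. apply Z.sgn_null_iff. destruct E as [E|[E|E]]; unfold z; rewrite E.
        - apply (chi_diag p j l).
        - apply (chi_diag p l j).
        - apply (chi_diag p l i). }
      destruct (Nat.eqb_spec i j), (Nat.eqb_spec i l), (Nat.eqb_spec j l);
      try (rewrite Hz by auto); cbn [indic] in *; try congruence; try lia; cbn; lia.
    - rewrite sum3_all_diff, <- H. apply Z.eq_le_incl. apply sum2_ext. intros.
      symmetry. apply sum_add. }
  intros E0. unfold chi, orient in E0. apply (proj1 (Z.sgn_null_iff _)) in E0.
  rewrite E0 in E. revert E. unfold all_diff3, all_diff2.
  destruct (Nat.eqb_spec i j), (Nat.eqb_spec i l), (Nat.eqb_spec j l); try contradiction.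
  cbn. lia.
Qed.

Lemma base_crossings :
  (3 <= m)%nat ->
  crossings (chi p) m =
  Z.of_nat m * (Z.of_nat m - 1) * (Z.of_nat m - 2) * (Z.of_nat m - 3) - 4 * v.
Proof.
  intros Hm. rewrite <- (crossings_sep p m (base_general Hm)), sum_sep.
  destruct separations_checked as [<- _]. ring.
Qed.

Lemma base_half i : (i < m)%nat ->
  sum1 m (fun j => indic (side i j =? 1)) = Z.of_nat h /\
  sum1 m (fun j => indic (side i j =? -1)) = Z.of_nat h.
Proof.
  intros Hi. unfold halved in b_halved. rewrite forallb_forall in b_halved.
  specialize (b_halved (nth i b o) (nth_In _ _ Hi)).
  rewrite sides_checked in b_halved. apply andb_prop in b_halved.
  destruct b_halved as [H1 H2]. apply Z.eqb_eq in H1, H2.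
  rewrite <- H1 at 1. rewrite <- H2. unfold count_pos, count_neg.
  split; apply sum_ext; intros j _; unfold side, d, p; set (z := det _ _);
  destruct (Z.sgn_spec z) as [[? ->]|[[? ->]|[? ->]]];
  destruct (Z.ltb_spec 0 z), (Z.ltb_spec z 0); cbn; lia.
Qed.

(** The two sides together hold [2 * h = m - 1] points and point [i] lies on its own line, so no
    other point does. *)
Lemma base_side_nonzero i j :
  m = (2 * h + 1)%nat -> (i < m)%nat -> (j < m)%nat -> i <> j -> side i j <> 0.
Proof.
  intros Hm Hi Hj N E. destruct (base_half i Hi) as [H1 H2].
  assert (indic (side i j =? 1) + indic (side i j =? -1) = 1 + -1 * indic (i =? j)%nat) as H.
  { apply (sum_le_eq m (fun j => indic (side i j =? 1) + indic (side i j =? -1))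
      (fun j => 1 + -1 * indic (i =? j)%nat)); [|..|assumption].
    - intros l _. destruct (Nat.eqb_spec i l) as [<-|].
      + unfold side, det, vec. cbn [fst snd]. rewrite !Z.sub_diag, !Z.mul_0_r. reflexivity.
      + destruct (Z.eqb_spec (side i l) 1), (Z.eqb_spec (side i l) (-1)); cbn; lia.
    - rewrite !sum_add, sum_scal, sum_const, sum_indic_eq, H1, H2 by assumption. lia. }
  rewrite E in H. destruct (Nat.eqb_spec i j); [contradiction|]. cbn in H. lia.
Qed.

End Checker.

(** * Recursion *)

Lemma zgeneral_prefix s n n' : (n' <= n)%nat -> zgeneral s n -> zgeneral s n'.
Proof. intros H [H1 H2]. split; intros; [apply H1|apply H2]; auto; lia. Qed.

Lemma crossings_monotone f n n' : (n' <= n)%nat -> crossings f n' <= crossings f n.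
Proof.
  intros H. unfold crossings, sum4, sum3, sum2.
  assert (forall g u, (forall i, 0 <= g i) -> 0 <= sum1 u g) as Hnn by (intros; now apply sum_nonneg).
  transitivity (sum1 n' (fun a => sum1 n (fun b => sum1 n (fun c => sum1 n (fun d =>
    indic (crossb f a b c d)))))).
  - apply sum_le; intros a _.
    transitivity (sum1 n' (fun b => sum1 n (fun c => sum1 n (fun d => indic (crossb f a b c d))))).
    + apply sum_le; intros b _.
      transitivity (sum1 n' (fun c => sum1 n (fun d => indic (crossb f a b c d)))).
      * apply sum_le; intros c _. apply sum_monotone; [assumption|]. intros. apply indic_bounds.
      * apply sum_monotone; [assumption|]. intros. apply Hnn. intros. apply indic_bounds.
    + apply sum_monotone; [assumption|]. intros. repeat (apply Hnn; intros). apply indic_bounds.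
  - apply sum_monotone; [assumption|]. intros. repeat (apply Hnn; intros). apply indic_bounds.
Qed.

Lemma crossings_le_pow4 f n : crossings f n <= Z.of_nat n ^ 4.
Proof.
  transitivity (sum4 n (fun _ _ _ _ => 1)).
  - apply sum4_le. intros. apply indic_bounds.
  - unfold sum4, sum3, sum2. rewrite !sum_const. apply Z.eq_le_incl. ring.
Qed.

(** Rounding up costs [15 * g * m * n ^ 3], where 15 = 4 + 6 + 4 + 1 comes from expanding
    [(n + m) ^ 4] with [m < n]. Since [m * k <= 2 * n] and [m >= 3], the old cubic error shrinks to
    at most 8/9 of [e * n ^ 3]. The remaining ninth pays for the rounding exactly when
    [e = 9 * 15 * g * m]. *)
Lemma induction_step_bound g m n k e :
  3 <= m -> m < n -> 0 <= g -> 0 <= k -> n <= m * k <= n + m - 1 -> e = 135 * g * m ->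
  g * (m * k) ^ 4 + m * (e * k ^ 3) <= g * n ^ 4 + e * n ^ 3.
Proof.
  intros Hm Hn Hg Hk Hmk He.
  assert (0 <= e) as He0 by (subst e; apply Z.mul_nonneg_nonneg; lia).
  assert ((m * k) ^ 4 <= n ^ 4 + 15 * m * n ^ 3) as H4.
  { transitivity ((n + m) ^ 4); [apply Z.pow_le_mono_l; nia|].
    replace ((n + m) ^ 4) with (n ^ 4 + m * (4 * n ^ 3 + 6 * n ^ 2 * m + 4 * n * m ^ 2 + m ^ 3)) by ring.
    assert (m * n ^ 2 <= n ^ 3) by nia.
    assert (n * m ^ 2 <= n ^ 3) by nia.
    assert (m ^ 3 <= n ^ 3) by (apply Z.pow_le_mono_l; lia).
    nia. }
  assert ((m * k) ^ 3 <= 8 * n ^ 3) as H3.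
  { replace (8 * n ^ 3) with ((2 * n) ^ 3) by ring. apply Z.pow_le_mono_l. nia. }
  assert (9 * (m * k ^ 3) <= 8 * n ^ 3) as H3'.
  { transitivity ((m * k) ^ 3); [|assumption].
    replace ((m * k) ^ 3) with (m ^ 2 * (m * k ^ 3)) by ring.
    apply Z.mul_le_mono_nonneg_r; [|nia]. apply Z.mul_nonneg_nonneg; [lia|].
    now apply Z.pow_nonneg. }
  assert (g * (m * k) ^ 4 <= g * (n ^ 4 + 15 * m * n ^ 3)) as G4
    by (apply Z.mul_le_mono_nonneg_l; assumption).
  assert (e * (9 * (m * k ^ 3)) <= e * (8 * n ^ 3)) as G3
    by (apply Z.mul_le_mono_nonneg_l; assumption).
  replace (e * (8 * n ^ 3)) with (9 * (e * n ^ 3) - e * n ^ 3) in G3 by ring.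
  replace (g * (n ^ 4 + 15 * m * n ^ 3)) with (g * n ^ 4 + 15 * g * m * n ^ 3) in G4 by ring.
  assert (e * n ^ 3 = 9 * (15 * g * m * n ^ 3)) as E3 by (subst e; ring).
  replace (e * (9 * (m * k ^ 3))) with (9 * (m * (e * k ^ 3))) in G3 by ring.
  clear - G3 G4 E3. lia.
Qed.

Section Recursion.

Variables (m h : nat) (p d : nat -> Z * Z) (num den : Z).
Hypothesis Hm : (3 <= m)%nat.
Hypothesis p_general : zgeneral p m.
Let side a b := Z.sgn (det (d a) (vec (p a) (p b))).
Hypothesis side_nonzero : forall a b, (a < m)%nat -> (b < m)%nat -> a <> b -> side a b <> 0.
Hypothesis side_half : forall a, (a < m)%nat ->
  sum1 m (fun b => indic (side a b =? 1)) = Z.of_nat h /\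
  sum1 m (fun b => indic (side a b =? -1)) = Z.of_nat h.
Hypothesis ratio_pos : 0 < den < 45 * num.
Hypothesis ratio_le :
  (3 * crossings (chi p) m + 12 * (Z.of_nat m * Z.of_nat h * (Z.of_nat h - 1)) +
   3 * (Z.of_nat m * (Z.of_nat m - 1)) + 4 * (Z.of_nat m * Z.of_nat h)) * den +
  Z.of_nat m * num <= num * Z.of_nat m ^ 4.

Lemma exists_few_crossings n :
  exists s, zgeneral s n /\
  3 * den * crossings (chi s) n <=
  num * Z.of_nat n ^ 4 + 135 * num * Z.of_nat m * Z.of_nat n ^ 3.
Proof.
  induction n as [n IH] using lt_wf_ind.
  destruct (le_lt_dec n m) as [Hn|Hn].
  - exists p. split; [now apply (zgeneral_prefix p m)|].
    (* For [n <= m] the trivial bound fits into the cubic term, because [den < 45 * num] gives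
       [3 * den < 135 * num]. *)
    pose proof (crossings_le_pow4 (chi p) n) as H.
    assert (Z.of_nat n ^ 4 <= Z.of_nat m * Z.of_nat n ^ 3) as H'.
    { replace (Z.of_nat n ^ 4) with (Z.of_nat n * Z.of_nat n ^ 3) by ring.
      apply Z.mul_le_mono_nonneg_r; [apply Z.pow_nonneg; lia | lia]. }
    assert (0 <= Z.of_nat n ^ 4) by (apply Z.pow_nonneg; lia).
    transitivity (3 * den * (Z.of_nat m * Z.of_nat n ^ 3)).
    + apply Z.mul_le_mono_nonneg_l; lia.
    + transitivity (135 * num * (Z.of_nat m * Z.of_nat n ^ 3)); [|nia].
      apply Z.mul_le_mono_nonneg_r; lia.
  - set (k := ((n + m - 1) / m)%nat).
    pose proof (Nat.div_mod_eq (n + m - 1) m) as E. fold k in E.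
    pose proof (Nat.mod_upper_bound (n + m - 1) m ltac:(lia)) as E'.
    destruct (IH k) as (s & Hs & Hc); [nia|].
    destruct (exists_blowup m k h p d s Hm p_general Hs side_nonzero side_half) as (s' & Hs' & Hc').
    exists s'. split; [apply (zgeneral_prefix s' (m * k)); [nia|assumption]|].
    pose proof (crossings_monotone (chi s') (m * k) n ltac:(nia)) as Hn'.
    etransitivity; [|apply (induction_step_bound num (Z.of_nat m) (Z.of_nat n) (Z.of_nat k)); try lia; nia].
    set (A := 3 * crossings (chi p) m + _ + _ + _) in *.
    set (u := Z.of_nat k) in *. set (M := Z.of_nat m) in *.
    assert (0 <= u ^ 4) as Hu by (apply Z.pow_nonneg; lia).
    transitivity (den * (u ^ 4 * A + 3 * M * crossings (chi s) k)).
    + transitivity (den * (3 * crossings (chi s') (m * k))); [|apply Z.mul_le_mono_nonneg_l; lia].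
      replace (3 * den * _) with (den * (3 * crossings (chi s') n)) by ring.
      apply Z.mul_le_mono_nonneg_l; lia.
    + replace (den * (u ^ 4 * A + 3 * M * crossings (chi s) k)) with
        (u ^ 4 * (A * den) + M * (3 * den * crossings (chi s) k)) by ring.
      (* The reserve [- M * num] left by [ratio_le] pays for the quartic terms of the [m] copies of
         [s]. *)
      transitivity (u ^ 4 * (num * M ^ 4 - M * num) +
        M * (num * u ^ 4 + 135 * num * M * u ^ 3)); [|apply Z.eq_le_incl; ring].
      apply Z.add_le_mono; apply Z.mul_le_mono_nonneg_l; lia.
Qed.

End Recursion.

(** * The base configuration *)

(* 93 points with 1087847 crossings, found by simulated annealing; the second
   component of each entry is the direction of a halving line through the point
   given by the first one. *)
Definition base : list ((Z * Z) * (Z * Z)) :=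
  [ ((-172739, 1390497), (-147, 1013)); ((-173150, -168060), (669, 775));
    ((-2206382, -2496720), (2695, 3084)); ((-171381, -166014), (84, 97));
    ((-39094, 435511), (-1, 8)); ((-68732, -45730), (1, 2));
    ((96947, 6449), (-254, 35)); ((-72070, -51525), (2, 3));
    ((157593, -6587), (127, 18)); ((22919, 68796), (-6, 5));
    ((121523, 8570), (-16, 1)); ((-642236, -706064), (43, 48));
    ((-72046, -51492), (19, 26)); ((36352, 14837), (-8, 1));
    ((826016, 79192), (16251, 2085)); ((-116578, -125492), (11, 12));
    ((1377123, 149857), (1016, 125)); ((-69123, -46635), (23, 60));
    ((-38335, 429473), (-35, 254)); ((154695, -7003), (32, 5));
    ((36182, 15470), (-7, 31)); ((141891, -345), (-8, 3));
    ((264, 141979), (3, 16)); ((2574916, 300150), (16256, 2047));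
    ((1903691, 215902), (8, 1)); ((-871788, -969364), (1347, 1542));
    ((-140783, -140769), (50, 39)); ((101191, 8890), (-2, 0));
    ((-53216, 540788), (-18, 127)); ((-69033, -46407), (6, 15));
    ((-2284720, -2586303), (5392, 6167)); ((-1389664, -1562288), (337, 386));
    ((168064, -5092), (63, 9)); ((2496718, 290337), (127, 16));
    ((166015, -5368), (-250, 53)); ((-435512, -474604), (85, 96));
    ((45730, -23003), (2, 1)); ((-6450, 90496), (61, 508));
    ((51527, -20545), (8, 3)); ((6582, 164182), (-41, 253));
    ((-68796, -45873), (3, 7)); ((-8610, 112939), (1, 16));
    ((706052, 63826), (127, 13)); ((51493, -20555), (15, 4));
    ((-14836, 21517), (5, 64)); ((-79193, 746827), (-1193, 8105));
    ((125487, 8908), (16, 1)); ((-149861, 1227264), (-285, 2028));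
    ((46631, -22489), (249, 59)); ((-429395, -467737), (170, 191));
    ((7002, 161694), (-3, 16)); ((-15471, 20711), (5, 6));
    ((345, 142230), (1, 4)); ((-141992, -141719), (3, 2));
    ((-300150, 2274763), (-73, 507)); ((-215907, 1687767), (-9, 63));
    ((969364, 97576), (2032, 257)); ((140769, -14), (-31, 9));
    ((-8891, 92298), (0, 2)); ((-540788, -594005), (2699, 3081));
    ((46400, -22633), (27, 16)); ((2586301, 301583), (4064, 511));
    ((1562286, 172615), (63, 8)); ((5090, 173138), (-5, 32));
    ((-290339, 2206435), (-585, 4054)); ((5364, 171376), (-39, 253));
    ((474602, 39091), (64, 7)); ((23003, 68730), (-1, 1));
    ((-90497, -96947), (192, 169)); ((20544, 72073), (-1, 2));
    ((-164187, -157605), (83, 97)); ((45872, -22922), (7, 4));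
    ((-112955, -121528), (23, 22)); ((-63826, 642244), (-7, 64));
    ((20552, 72045), (-9, 13)); ((-21536, -36358), (12, 11));
    ((-746821, -826013), (10865, 12264)); ((-8914, 116574), (-1, 16));
    ((-1227150, -1376992), (675, 770)); ((22485, 69121), (-55, 33));
    ((467892, 38347), (254, 31)); ((-161699, -154696), (41, 49));
    ((-20712, -36183), (16, 3)); ((-142233, -141890), (13, 10));
    ((141721, -273), (-2, 1)); ((-2274767, -2574918), (674, 771));
    ((-1687750, -1903643), (21, 24)); ((-97576, 871786), (-293, 2027));
    ((14, 140782), (7, 31)); ((-92301, -101194), (1, 1));
    ((593990, 53217), (508, 63)); ((22632, 69033), (-3, 2));
    ((-301582, 2284715), (-583, 4054)) ].

Lemma base_separations :
  separations (map fst base) = (15342716, 93 * (93 - 1) * (93 - 2)).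
Proof. vm_compute. reflexivity. Qed.

Lemma base_halved : halved 46 base = true.
Proof. vm_compute. reflexivity. Qed.

(** * Real points *)

Open Scope R_scope.

Definition to_point (z : Z * Z) : point := (IZR (fst z), IZR (snd z)).

Definition rorient (a b c : point) : R :=
  (fst b - fst a) * (snd c - snd a) - (snd b - snd a) * (fst c - fst a).

Lemma rorient_to_point a b c :
  rorient (to_point a) (to_point b) (to_point c) = IZR (orient a b c).
Proof.
  unfold rorient, orient, det, vec, to_point. cbn [fst snd].
  rewrite minus_IZR, !mult_IZR, !minus_IZR. ring.
Qed.

Lemma collinear_orient a b c : collinear a b c -> rorient a b c = 0.
Proof.
  intros (al & be & ga & Hn & Ha & Hb & Hc).
  set (o := rorient a b c).
  assert (al * o = 0).
  { unfold o, rorient. replace (al * _) with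
      ((al * fst b - al * fst a) * (snd c - snd a) - (snd b - snd a) * (al * fst c - al * fst a)) by ring.
    replace (al * fst a) with (ga - be * snd a) by lra.
    replace (al * fst b) with (ga - be * snd b) by lra.
    replace (al * fst c) with (ga - be * snd c) by lra. ring. }
  assert (be * o = 0).
  { unfold o, rorient. replace (be * _) with
      ((fst b - fst a) * (be * snd c - be * snd a) - (be * snd b - be * snd a) * (fst c - fst a)) by ring.
    replace (be * snd a) with (ga - al * fst a) by lra.
    replace (be * snd b) with (ga - al * fst b) by lra.
    replace (be * snd c) with (ga - al * fst c) by lra. ring. }
  destruct Hn as [Hn|Hn]; [apply Rmult_integral in H|apply Rmult_integral in H0]; tauto.
Qed.

(** Orientation against the line [ab] is affine along [cd] and vanishes at the common point, which
    lies strictly inside [cd]. Unless both end values vanish, they have opposite signs. *)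
Lemma crossing_orient_product a b c d s t :
  0 < t < 1 ->
  fst a + s * (fst b - fst a) = fst c + t * (fst d - fst c) ->
  snd a + s * (snd b - snd a) = snd c + t * (snd d - snd c) ->
  rorient a b c <> 0 \/ rorient a b d <> 0 -> rorient a b c * rorient a b d < 0.
Proof.
  intros Ht E1 E2 H.
  assert ((1 - t) * rorient a b c + t * rorient a b d = 0) as E.
  { unfold rorient.
    replace ((1 - t) * _ + _) with
      ((fst b - fst a) * (snd c + t * (snd d - snd c) - snd a) -
       (snd b - snd a) * (fst c + t * (fst d - fst c) - fst a)) by ring.
    rewrite <- E1, <- E2. ring. }
  set (u := rorient a b c) in *. set (v := rorient a b d) in *. clearbody u v.
  assert (u = - (t / (1 - t)) * v) as Eu by (field_simplify_eq; lra).
  assert (0 < t / (1 - t)) by (apply Rdiv_lt_0_compat; lra).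
  assert (v <> 0) by (intros ->; rewrite Rmult_0_r in Eu; lra).
  rewrite Eu. assert (0 < v * v) by (destruct (Rdichotomy v 0); nra). nra.
Qed.

Lemma orient_product_cross a b c d :
  rorient a b c * rorient a b d < 0 -> rorient c d a * rorient c d b < 0 ->
  segments_cross a b c d.
Proof.
  intros H1 H2.
  (* Each parameter is the zero of the affine function that measures orientation against the line
     through the other segment. *)
  exists (rorient c d a / (rorient c d a - rorient c d b)),
         (rorient a b c / (rorient a b c - rorient a b d)).
  assert (forall u v, u * v < 0 -> u - v <> 0 /\ 0 < u / (u - v) < 1) as Hq.
  { intros u v Huv. destruct (Rlt_or_le 0 u).
    - assert (v < 0) by nra. split; [lra|]. split.
      + apply Rdiv_lt_0_compat; lra.
      + apply (Rmult_lt_reg_r (u - v)); [lra|]. field_simplify; lra.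
    - assert (u <> 0) by (intros ->; lra). assert (0 < v) by nra. split; [lra|].
      replace (u / (u - v)) with (- u / (v - u)) by (field; lra). split.
      + apply Rdiv_lt_0_compat; lra.
      + apply (Rmult_lt_reg_r (v - u)); [lra|]. field_simplify; lra. }
  destruct (Hq _ _ H1) as [N1 B1]. destruct (Hq _ _ H2) as [N2 B2].
  split; [assumption|]. split; [assumption|].
  unfold rorient in *. split; field; split; assumption.
Qed.

(** The disjunctions admit edges with a common endpoint, where some orientations vanish. They
    exclude segments overlapping on one line, which satisfy [segments_cross] but not [crossb]. *)
Lemma segments_cross_crossb s a b c d :
  (chi s a b c <> 0 \/ chi s a b d <> 0)%Z -> (chi s c d a <> 0 \/ chi s c d b <> 0)%Z ->
  segments_cross (to_point (s a)) (to_point (s b)) (to_point (s c)) (to_point (s d)) <->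
  crossb (chi s) a b c d = true.
Proof.
  intros H1 H2.
  assert (forall i j k l, (chi s i j k * chi s i j l <? 0)%Z = true <->
    rorient (to_point (s i)) (to_point (s j)) (to_point (s k)) *
    rorient (to_point (s i)) (to_point (s j)) (to_point (s l)) < 0) as Hs.
  { intros i j k l. rewrite !rorient_to_point, <- mult_IZR, Z.ltb_lt. unfold chi.
    rewrite <- Z.sgn_mul. split; intros H.
    - apply IZR_lt. pose proof (Z.sgn_spec (orient (s i) (s j) (s k) * orient (s i) (s j) (s l))). lia.
    - apply lt_IZR in H. rewrite Z.sgn_neg; lia. }
  assert (forall i j k, chi s i j k <> 0%Z ->
    rorient (to_point (s i)) (to_point (s j)) (to_point (s k)) <> 0) as Hn.
  { intros i j k H E. rewrite rorient_to_point in E. apply eq_IZR in E.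
    apply H. unfold chi. now rewrite E. }
  unfold crossb. rewrite andb_true_iff, !Hs. split.
  - intros (u & t & Hu & Ht & E1 & E2). split.
    + apply (crossing_orient_product _ _ _ _ u t); auto. destruct H1; auto.
    + apply (crossing_orient_product _ _ _ _ t u); auto. destruct H2; auto.
  - intros [G1 G2]. now apply orient_product_cross.
Qed.

Open Scope Z_scope.

(** * From ordered quadruples to the list of crossing edge pairs *)

Definition edgeb (i j k l : nat) : bool :=
  ((i <? j) && (k <? l) && ((i <? k) || ((i =? k) && (j <? l))))%nat.

Lemma edgeb_spec i j k l :
  reflect (i < j /\ k < l /\ (i < k \/ i = k /\ j < l))%nat (edgeb i j k l).
Proof.
  apply iff_reflect. unfold edgeb.
  rewrite !andb_true_iff, orb_true_iff, andb_true_iff, !Nat.ltb_lt, Nat.eqb_eq. lia.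
Qed.

Lemma edge_images_le_1 a b c d :
  let E a b c d := indic (edgeb a b c d) in
  E a b c d + E b a c d + (E a b d c + E b a d c) +
  (E c d a b + E c d b a + (E d c a b + E d c b a)) <= 1.
Proof.
  intros E. unfold E.
  destruct (edgeb_spec a b c d), (edgeb_spec b a c d); try lia;
  destruct (edgeb_spec a b d c), (edgeb_spec b a d c); try lia;
  destruct (edgeb_spec c d a b), (edgeb_spec c d b a); try lia;
  destruct (edgeb_spec d c a b), (edgeb_spec d c b a); try lia; cbn; lia.
Qed.

(** Add up the eight relabellings that preserve the pair of edges. All of them have the same sum and
    the same value of [crossb], and at most one is in the normal form tested by [edgeb]. *)
Lemma edge_crossings_le f n : chirotope f ->
  8 * sum4 n (fun a b c d => indic (edgeb a b c d && crossb f a b c d)) <= crossings f n.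
Proof.
  intros Hf.
  set (E a b c d := indic (edgeb a b c d)). set (X a b c d := indic (crossb f a b c d)).
  set (g a b c d := E a b c d * X a b c d).
  assert (sum4 n (fun a b c d => indic (edgeb a b c d && crossb f a b c d)) = sum4 n g) as ->.
  { apply sum4_ext. intros. unfold g, E, X.
    destruct (edgeb a b c d), (crossb f a b c d); reflexivity. }
  transitivity (sum4 n (fun a b c d => g a b c d + g b a c d + (g a b d c + g b a d c) +
    (g c d a b + g c d b a + (g d c a b + g d c b a)))).
  - rewrite !sum4_add.
    rewrite (sum4_swap12 n g), (sum4_swap34 n g), (sum4_swap_pairs n g),
      (sum4_swap34 n (fun a b c d => g b a c d)), (sum4_swap12 n g),
      (sum4_swap_pairs n (fun a b c d => g a b d c)), (sum4_swap34 n g),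
      (sum4_swap_pairs n (fun a b c d => g b a c d)), (sum4_swap12 n g),
      (sum4_swap_pairs n (fun a b c d => g b a d c)),
      (sum4_swap34 n (fun a b c d => g b a c d)), (sum4_swap12 n g). lia.
  - apply sum4_le. intros a b c d _ _ _ _. unfold g, X.
    rewrite !(crossb_swap_l f a b), !(crossb_swap_l f c d), !(crossb_swap_r f a b c d),
      !(crossb_swap_r f c d a b), !(crossb_swap_pairs f a b c d) by assumption.
    pose proof (edge_images_le_1 a b c d) as H. cbn zeta in H. fold E in H.
    change (fun a b c d => indic (edgeb a b c d)) with E in H.
    rewrite <- !Z.mul_add_distr_r, <- Z.mul_1_l.
    apply Z.mul_le_mono_nonneg_r; [apply indic_bounds|exact H].
Qed.

Fixpoint list_zsum {T} (g : T -> Z) (l : list T) : Z :=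
  match l with nil => 0 | a :: l => g a + list_zsum g l end.

Lemma list_sum_app {T} (g : T -> Z) l l' : list_zsum g (l ++ l') = list_zsum g l + list_zsum g l'.
Proof. induction l as [|a l IH]; cbn; lia. Qed.

Lemma list_sum_prod {T U} (g : T * U -> Z) l l' :
  list_zsum g (list_prod l l') = list_zsum (fun a => list_zsum (fun b => g (a, b)) l') l.
Proof.
  induction l as [|a l IH]; [reflexivity|].
  cbn. rewrite list_sum_app, IH. f_equal.
  clear IH. induction l' as [|b l' IH]; [reflexivity|]. cbn. rewrite IH. reflexivity.
Qed.

Lemma list_sum_seq g n : list_zsum g (seq 0 n) = sum1 n g.
Proof.
  induction n as [|n IH]; [reflexivity|]. rewrite seq_S, list_sum_app, IH. cbn. lia.
Qed.

Lemma length_filter_sum {T} (f : T -> bool) l :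
  Z.of_nat (length (filter f l)) = list_zsum (fun a => indic (f a)) l.
Proof.
  induction l as [|a l IH]; [reflexivity|]. cbn.
  destruct (f a); cbn [length indic]; lia.
Qed.

Lemma NoDup_list_prod {T U} (l : list T) (l' : list U) :
  NoDup l -> NoDup l' -> NoDup (list_prod l l').
Proof.
  intros Hl Hl'. induction Hl as [|a l Ha Hl IH]; [constructor|]. cbn.
  apply NoDup_app; [|assumption|].
  - apply Injective_map_NoDup; [|assumption]. intros u v E. congruence.
  - intros [u v] H1 H2. apply in_map_iff in H1. destruct H1 as (w & E & _).
    apply in_prod_iff in H2. injection E as -> _. tauto.
Qed.

Lemma exists_cr_bar s n : zgeneral s n ->
  exists k, cr_bar_eq (fun i => to_point (s i)) n k /\ 8 * Z.of_nat k <= crossings (chi s) n.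
Proof.
  intros [_ Hs]. set (r := seq 0 n).
  set (f := fun q : nat * nat * nat * nat =>
    let '(i, j, k, l) := q in edgeb i j k l && crossb (chi s) i j k l).
  set (qs := filter f (list_prod (list_prod (list_prod r r) r) r)).
  exists (length qs). split.
  - exists qs. split; [|split; [|reflexivity]].
    + apply NoDup_filter. repeat apply NoDup_list_prod; apply seq_NoDup.
    + intros [[[i j] k] l]. unfold qs. rewrite filter_In, !in_prod_iff. unfold r.
      rewrite !in_seq. unfold crossing_pair, edge_pair, f. rewrite andb_true_iff.
      destruct (edgeb_spec i j k l) as [E|E].
      * split.
        -- intros [(((Hi & Hj) & Hk) & Hl) [_ Hc]]. split; [lia|].
           apply segments_cross_crossb; [| |assumption].
           (* Distinct edges share at most one endpoint, so one endpoint of the second edge avoids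
              the first. *)
           ++ destruct (Nat.eq_dec k i), (Nat.eq_dec k j);
              solve [right; apply Hs; lia | left; apply Hs; lia].
           ++ destruct (Nat.eq_dec i k), (Nat.eq_dec i l);
              solve [right; apply Hs; lia | left; apply Hs; lia].
        -- intros [Hq Hc]. split; [lia|]. split; [reflexivity|].
           apply segments_cross_crossb; [| |assumption].
           ++ destruct (Nat.eq_dec k i), (Nat.eq_dec k j);
              solve [right; apply Hs; lia | left; apply Hs; lia].
           ++ destruct (Nat.eq_dec i k), (Nat.eq_dec i l);
              solve [right; apply Hs; lia | left; apply Hs; lia].
      * split; [intros (_ & ? & _); congruence | intros (Hq & _); lia].
  - unfold qs. rewrite length_filter_sum, !list_sum_prod. unfold r.
    rewrite <- (edge_crossings_le (chi s) n (chi_chirotope s)).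
    apply Z.eq_le_incl. f_equal.
    rewrite list_sum_seq. apply sum_ext. intros a _.
    rewrite list_sum_seq. apply sum_ext. intros b _.
    rewrite list_sum_seq. apply sum_ext. intros c _.
    apply list_sum_seq.
Qed.

Lemma zgeneral_general_position s n :
  zgeneral s n -> general_position (fun i => to_point (s i)) n.
Proof.
  intros [Hd Hs]. split.
  - intros i j Hi Hj N E. apply (Hd i j Hi Hj N). unfold to_point in E.
    injection E as E1 E2. apply eq_IZR in E1, E2.
    rewrite (surjective_pairing (s i)), (surjective_pairing (s j)). congruence.
  - intros i j k Hi Hj Hk N1 N2 N3 Hc. apply collinear_orient in Hc.
    rewrite rorient_to_point in Hc. apply eq_IZR in Hc.
    apply (Hs i j k Hi Hj Hk N1 N2 N3). unfold chi. now rewrite Hc.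
Qed.

Open Scope R_scope.

Lemma binomial_4_lower n :
  (4 <= n)%nat -> (INR n ^ 4 - 6 * INR n ^ 3 <= 24 * Binomial.C n 4)%R.
Proof.
  intros Hn. replace n with (n - 4 + 4)%nat by lia. set (j := (n - 4)%nat).
  unfold Binomial.C. replace (j + 4 - 4)%nat with j by lia.
  replace (j + 4)%nat with (S (S (S (S j)))) by lia.
  rewrite !fact_simpl, !mult_INR, !S_INR. change (INR (fact 0)) with 1%R. change (INR 0) with 0%R.
  pose proof (INR_fact_neq_0 j) as Hf. pose proof (pos_INR j) as Hj.
  set (x := INR j) in *.
  match goal with |- (_ <= 24 * ?c)%R =>
    replace (24 * c)%R with ((x + 4) * (x + 3) * (x + 2) * (x + 1))%R by (field; assumption) end.
  nra.
Qed.

(* cr_bar(K_n) <= bound  <=>  some n-point set S in general position has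
   cr_bar(S) <= bound (the minimum is over a nonempty family). *)
Theorem theorem1 :
  exists K : R, K > 0 /\
    forall n : nat, (4 <= n)%nat ->
      exists P : nat -> point, general_position P n /\
        exists m : nat, cr_bar_eq P n m /\
          INR m <= 9363184 / 24609375 * Binomial.C n 4 + K * INR n ^ 3.
Proof.
  (* Generous: [(135 * 93 + 6) / 24] times the ratio, about 200, would do, the 6 coming from
     [binomial_4_lower]. *)
  exists (10000)%R. split; [lra|]. intros n Hn.
  destruct (exists_few_crossings 93 46 (fun i => fst (nth i base ((0, 0), (0, 0))%Z))
    (fun i => snd (nth i base ((0, 0), (0, 0))%Z)) 9363184 24609375) with (n := n) as (s & Hs & Hc).
  - lia.
  - exact (base_general base _ base_separations ltac:(cbn; lia)).
  - intros i j. exact (base_side_nonzero base 46 base_halved i j eq_refl).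
  - exact (base_half base 46 base_halved).
  - lia.
  (* Once [crossings] is replaced by its value, the bound on q is a comparison of closed
     integers. *)
  - rewrite (base_crossings base _ base_separations ltac:(cbn; lia) : crossings _ 93 = _).
    vm_compute. discriminate.
  - exists (fun i => to_point (s i)). split; [now apply zgeneral_general_position|].
    destruct (exists_cr_bar s n Hs) as (k & Hk & Hle). exists k. split; [assumption|].
    (* Here 24 = 3 * 8: the factor 3 of the recursion and the eightfold count of every crossing. *)
    assert (24 * 24609375 * Z.of_nat k <=
      9363184 * Z.of_nat n ^ 4 + 135 * 9363184 * 93 * Z.of_nat n ^ 3)%Z as H by lia.
    change 4%Z with (Z.of_nat 4) in H. change 3%Z with (Z.of_nat 3) in H.
    apply IZR_le in H. rewrite plus_IZR, !mult_IZR, <- !pow_IZR, <- !INR_IZR_INZ in H.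
    pose proof (binomial_4_lower n Hn).
    assert (0 <= INR n ^ 3)%R by (apply pow_le, pos_INR). lra.
Qed.
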